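(* Let $A$ be a $C^*$-algebra (possibly nonunital), and suppose that $0\neq a\in A$ is not approximately right invertible. Then $a$ is not an isolated point of the orthograph $\Gamma(A)$; that is, there is a nonzero $b\in A$ with $a\mathrel{\perp\!\!\!\!\perp}^S b$.
   Context: Let $A$ be a $C^*$-algebra. An element $a\in A$ is approximately right invertible if there is a net $\{b_i\}_{i\in I}$ in $A$ such that $\{ab_i\}_{i\in I}$ is an approximate unit for $A$. For $a,b\in A$, $a$ is strong $BJ$-orthogonal to $b$, written $a\perp^S b$, if $\|a+bc\|\ge\|a\|$ for every $c\in A$. The elements $a,b$ are mutually strong $BJ$-orthogonal, written $a\mathrel{\perp\!\!\!\!\perp}^S b$, if $a\perp^S b$ and $b\perp^S a$. These relations do not change when $a$, $b$ are replaced by nonzero scalar multiples. The orthograph $\Gamma(A)$ is the graph whose vertex set is the projective space $S=(A\setminus\{0\})/(a\sim\lambda a,\ \lambda\in\mathbb C\setminus\{0\})$ and whose edges are the pairs $(a,b)\in S\times S$ with $a\mathrel{\perp\!\!\!\!\perp}^S b$. A nonzero element is identified with the vertex it represents. An isolated point (isolated vertex) is a vertex belonging to no edge. *)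

(* Defs.v *)
From HB Require Import structures.
From mathcomp Require Import all_boot all_order all_algebra.
From mathcomp Require Import complex.
From mathcomp Require Import all_classical all_reals all_analysis.

Set Implicit Arguments.
Unset Strict Implicit.
Unset Printing Implicit Defensive.

Import Order.TTheory GRing.Theory Num.Theory.
Import numFieldNormedType.Exports.

Local Open Scope classical_set_scope.
Local Open Scope ring_scope.
Local Open Scope quotient_scope.

Declare Scope cstar_scope.
Delimit Scope cstar_scope with cstar.
Local Open Scope cstar_scope.

(** MathComp rings are unital, so the (possibly nonunital) multiplication is
    part of the mixin.  The norm of a normed module over [R[i]] takes its values
    in [R[i]]; these values are nonnegative, hence real, and the order of [R[i]]
    restricts to the usual order on them. *)
HB.mixin Record CompleteNormedModule_isCStarAlgebra (R : realType) A
    of CompleteNormedModule R[i] A := {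
  cmul : A -> A -> A ;
  cstar : A -> A ;
  cmulA : associative cmul ;
  cmulDl : left_distributive cmul +%R ;
  cmulDr : right_distributive cmul +%R ;
  cmulZl : forall (l : R[i]) (x y : A), cmul (l *: x) y = l *: cmul x y ;
  cmulZr : forall (l : R[i]) (x y : A), cmul x (l *: y) = l *: cmul x y ;
  cstarK : involutive cstar ;
  cstarD : {morph cstar : x y / x + y} ;
  cstarZ : forall (l : R[i]) (x : A), cstar (l *: x) = l^* *: cstar x ;
  cstarM : forall x y : A, cstar (cmul x y) = cmul (cstar y) (cstar x) ;
  cnormM : forall x y : A, `|cmul x y| <= `|x| * `|y| ;
  cnorm_star_mul : forall x : A, `|cmul (cstar x) x| = `|x| ^+ 2
}.

#[short(type="cstarAlgType")]
HB.structure Definition CStarAlgebra (R : realType) :=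
  {A of CompleteNormedModule_isCStarAlgebra R A & CompleteNormedModule R[i] A}.

Notation "x ** y" := (cmul x y) (at level 40, left associativity) : cstar_scope.

Section ApproximateUnit.
Variables (R : realType) (A : cstarAlgType R).
Implicit Types a x y : A.

Definition cpositive x := exists y, x = cstar y ** y.

Definition cle x y := cpositive (y - x).

Record directed_set (I : Type) (le : I -> I -> Prop) : Prop := DirectedSet {
  directed_inhabited : inhabited I ;
  directed_refl : forall i, le i i ;
  directed_trans : forall i j k, le i j -> le j k -> le i k ;
  directed_ub : forall i j, exists k, le i k /\ le j k
}.

(** The filter of tails: [u @ net_filter le --> x] is convergence of the net
    [u] to [x]. *)
Definition net_filter (I : Type) (le : I -> I -> Prop) : set_system I :=
  filter_from setT (fun i => [set j | le i j]).

(** As usual for C*-algebras, an approximate unit is an increasing net of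
    positive elements of the closed unit ball. *)
Record approximate_unit (I : Type) (le : I -> I -> Prop) (u : I -> A) : Prop :=
  ApproximateUnit {
  approximate_unit_directed : directed_set le ;
  approximate_unit_positive : forall i, cpositive (u i) ;
  approximate_unit_norm : forall i, `|u i| <= 1 ;
  approximate_unit_increasing : forall i j, le i j -> cle (u i) (u j) ;
  approximate_unit_cvgl : forall x, (fun i => u i ** x) @ net_filter le --> x ;
  approximate_unit_cvgr : forall x, (fun i => x ** u i) @ net_filter le --> x
}.

Definition approximately_right_invertible a :=
  exists (I : Type) (le : I -> I -> Prop) (b : I -> A),
    approximate_unit le (fun i => a ** b i).

End ApproximateUnit.

Section Orthograph.
Variables (R : realType) (A : cstarAlgType R).
Definition strong_BJ (a b : A) := forall c, `|a| <= `|a + b ** c|.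

Definition mutual_strong_BJ (a b : A) := strong_BJ a b /\ strong_BJ b a.

Definition nonzero := {a : A | a != 0}.

Definition proj_rel : rel nonzero :=
  fun a b => `[< exists2 l : R[i], l != 0 & val b = l *: val a >].

Lemma proj_rel_refl : reflexive proj_rel.
Proof. by move=> a; apply/asboolP; exists 1; rewrite ?oner_eq0 ?scale1r. Qed.

Lemma proj_rel_sym : symmetric proj_rel.
Proof.
have H a b : proj_rel a b -> proj_rel b a.
  move=> /asboolP[l l0 eb]; apply/asboolP; exists l^-1; first by rewrite invr_eq0.
  by rewrite eb scalerA mulVf// scale1r.
by move=> a b; apply/idP/idP; exact: H.
Qed.

Lemma proj_rel_trans : transitive proj_rel.
Proof.
move=> b a c /asboolP[l l0 eb] /asboolP[m m0 ec]; apply/asboolP.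
by exists (m * l); [rewrite mulf_neq0 | rewrite ec eb scalerA].
Qed.

Canonical proj_equiv := EquivRel proj_rel proj_rel_refl proj_rel_sym proj_rel_trans.

Definition proj_space := {eq_quot proj_equiv}.

Definition vertex (a : A) (a0 : a != 0) : proj_space :=
  \pi_{eq_quot proj_equiv} (exist _ a a0 : nonzero).

(** [mutual_strong_BJ] is invariant under nonzero scalar multiples, so this is
    independent of the representatives. *)
Definition orthograph : proj_space -> proj_space -> Prop := fun p q =>
  exists (a b : A) (a0 : a != 0) (b0 : b != 0),
    [/\ p = vertex a0, q = vertex b0 & mutual_strong_BJ a b].

Definition isolated_point (p : proj_space) :=
  forall q, ~ (orthograph p q \/ orthograph q p).

End Orthograph.

(* Main.v *)
Require Import Defs.
From HB Require Import structures.
From Stdlib Require Ncring Ncring_tac.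
From mathcomp Require Import all_boot all_order all_algebra.
From mathcomp Require Import complex.
From mathcomp Require Import all_classical all_reals all_analysis.
From mathcomp Require Import ring lra.

(** Normalize [a] to norm [1] and put [e := a a^*], an element of norm [1] between
    [0] and [1].  The elements [1 - (1 - e)^n] of the right ideal [aA] are positive,
    bounded by [1] and increasing, and [(1 - e)^n a] tends to [0].  If [aA] is dense
    they are therefore an approximate unit, and [a] is approximately right
    invertible ([approximately_right_invertible_of_dense]).

    Otherwise some element lies at distance [1] from the closure of [aA].  Closed
    right ideals of a C*-algebra are proximinal, which yields [k] with norm and
    distance to [aA] both [1] ([proximinal]).  It is the limit of a sequence moving
    along [aA], each step of which ([truncation]) lowers the norm at the price of a
    small displacement.  Then [b := (1 - e) k] is the required neighbor
    ([norm1_mutual_neighbor]).  On the one hand [b + ac] belongs to [k + aA], so its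
    norm is at least [1], while that of [b] is at most [1].  On the other hand [e^n] is
    a contraction, [e^n a] has norm [1], and [e^n (1 - e)] tends to [0], so
    [a + (1 - e) y] has norm at least [1] for every [y].

    These arguments use the order of the unitization of [A], which rests on two
    facts.  One is a square root of [1 - t] for self-adjoint [t] of norm at most [1]
    ([sqrt_one_sub]).  The other is that every [x^* x] is the square of a self-adjoint
    element ([pos_star], the Kelley-Vaught theorem).  Norm bounds are deduced from
    positivity through unitary elements ([unitary_nle]). *)

Set Implicit Arguments.
Unset Strict Implicit.
Unset Printing Implicit Defensive.

Import Order.TTheory GRing.Theory Num.Theory.
Import numFieldNormedType.Exports.

Local Open Scope classical_set_scope.
Local Open Scope ring_scope.
Local Open Scope complex_scope.
Local Open Scope cstar_scope.

(** * Identities in noncommutative rings *)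

Section NoncommutativeRing.
Variable B : pzRingType.
#[export] Instance ncring_ops :
  @Ncring.Ring_ops B 0 1 +%R *%R (fun x y => x - y) -%R eq := {}.
#[export] Instance ncring_ring : Ncring.Ring (Ro := ncring_ops).
Proof.
split.
- exact: RelationClasses.eq_equivalence.
- by move=> x y -> z t ->.
- by move=> x y -> z t ->.
- by move=> x y -> z t ->.
- by move=> x y ->.
- exact: add0r.
- exact: addrC.
- exact: addrA.
- exact: mul1r.
- exact: mulr1.
- exact: mulrA.
- exact: mulrDl.
- move=> x y z; exact: mulrDr.
- by [].
- exact: subrr.
Qed.
End NoncommutativeRing.

Ltac ncring := Ncring_tac.non_commutative_ring.

(** * Unital C*-algebras through the balls of their norm *)

(** [nle x r] stands for a norm of [x] at most the real number [r].  Only upper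
    bounds of norms enter the arguments below, and a predicate avoids taking the
    supremum that defines an operator norm.  Completeness is asked for sequences
    whose increments are dominated by those of a bounded real sequence, the form
    in which both the square root and the inverse converge. *)
HB.mixin Record Algebra_isUnitalCStar (R : realType) B of GRing.Algebra R[i] B := {
  ustar : B -> B ;
  nle : B -> R -> Prop ;
  ustarK : involutive ustar ;
  ustarD : {morph ustar : x y / x + y} ;
  ustarZ : forall (l : R[i]) (x : B), ustar (l *: x) = (l^*)%R *: ustar x ;
  ustarM : forall x y : B, ustar (x * y) = ustar y * ustar x ;
  nle_ge0 : forall x r, nle x r -> 0 <= r ;
  nleW : forall x r s, r <= s -> nle x r -> nle x s ;
  nle_ex : forall x, exists r, nle x r ;
  nle_closed : forall x r, (forall e, 0 < e -> nle x (r + e)) -> nle x r ;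
  nle_eq0 : forall x, nle x 0 -> x = 0 ;
  nle1 : nle 1 1 ;
  nleD : forall x y r s, nle x r -> nle y s -> nle (x + y) (r + s) ;
  nleM : forall x y r s, nle x r -> nle y s -> nle (x * y) (r * s) ;
  nleZ : forall (l : R[i]) x c r, `|l| <= c%:C -> nle x r -> nle (l *: x) (c * r) ;
  nle_ustar : forall x r, nle x r -> nle (ustar x) r ;
  nle_sq : forall x r, 0 <= r -> nle (ustar x * x) (r ^+ 2) -> nle x r ;
  nle_complete : forall (u : nat -> B) (eta : nat -> R) K,
    (forall n, nle (u n.+1 - u n) (eta n.+1 - eta n)) -> (forall n, eta n <= K) ->
    exists l, forall e, 0 < e -> exists N, forall n, (N <= n)%N -> nle (l - u n) e
}.

#[short(type="unitalCStarType")]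
HB.structure Definition UnitalCStar (R : realType) :=
  {B of Algebra_isUnitalCStar R B & GRing.Algebra R[i] B}.

Arguments nle_ge0 {R s x r}.
Arguments nleW {R s x r}.
Arguments nle_complete {R s u eta K}.

Section UnitalCStar.
Variables (R : realType) (B : unitalCStarType R).
Implicit Types (x y z w t c : B) (r s M : R).

Definition selfadj x := ustar x = x.

(** The real scalars as central elements, so that ring identities cover scaling. *)
Definition rscal r : B := r%:C%:A.

Lemma rscalC r x : rscal r * x = x * rscal r.
Proof. by rewrite /rscal -scalerAl -scalerAr mul1r mulr1. Qed.
Lemma rscal0 : rscal 0 = 0. Proof. by rewrite /rscal scale0r. Qed.
Lemma rscal1 : rscal 1 = 1. Proof. by rewrite /rscal scale1r. Qed.
Lemma rscalD r s : rscal (r + s) = rscal r + rscal s.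
Proof. by rewrite /rscal rmorphD scalerDl. Qed.
Lemma rscalM r s : rscal (r * s) = rscal r * rscal s.
Proof. by rewrite /rscal rmorphM -scalerAl mul1r scalerA. Qed.

Lemma ustar1 : ustar (1 : B) = 1.
Proof.
have : ustar (ustar 1 * 1) = 1 :> B by rewrite mulr1 ustarK.
by rewrite ustarM ustarK mulr1.
Qed.
Lemma ustar0 : ustar (0 : B) = 0.
Proof. by apply: (addIr (ustar (0:B))); rewrite -ustarD !add0r. Qed.
Lemma ustarN x : ustar (- x) = - ustar x.
Proof. by apply: (addIr (ustar x)); rewrite -ustarD !addNr ustar0. Qed.
Lemma ustarB x y : ustar (x - y) = ustar x - ustar y.
Proof. by rewrite ustarD ustarN. Qed.
Lemma conjCR r : (r%:C^*)%R = r%:C :> R[i].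
Proof. by rewrite /Num.conj /= /conjc /= oppr0. Qed.
Lemma selfadj_rscal r : selfadj (rscal r).
Proof. by rewrite /selfadj /rscal ustarZ conjCR ustar1. Qed.
Lemma selfadj1 : selfadj 1. Proof. exact: ustar1. Qed.
Lemma selfadj0 : selfadj 0. Proof. exact: ustar0. Qed.
Lemma selfadjD x y : selfadj x -> selfadj y -> selfadj (x + y).
Proof. by rewrite /selfadj ustarD => -> ->. Qed.
Lemma selfadjN x : selfadj x -> selfadj (- x). Proof. by rewrite /selfadj ustarN => ->. Qed.
Lemma selfadjB x y : selfadj x -> selfadj y -> selfadj (x - y).
Proof. by move=> ? ?; apply/selfadjD => //; apply/selfadjN. Qed.
Lemma selfadjM x y : selfadj x -> selfadj y -> x * y = y * x -> selfadj (x * y).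
Proof. by rewrite /selfadj ustarM => -> ->. Qed.
Lemma selfadj_sq x : selfadj x -> selfadj (x * x). Proof. by move=> ?; apply: selfadjM. Qed.
Lemma selfadj_rscalM r x : selfadj x -> selfadj (rscal r * x).
Proof. by move=> xsa; apply: selfadjM => //; [exact: selfadj_rscal|exact: rscalC]. Qed.
Lemma selfadj_star x : selfadj (ustar x * x).
Proof. by rewrite /selfadj ustarM ustarK. Qed.

Lemma norm_realC r : `|r%:C| = `|r|%:C :> R[i].
Proof. by rewrite normc_def /= expr0n addr0 sqrtr_sqr. Qed.

Lemma nle_rscal r : nle (rscal r) `|r|.
Proof. by rewrite -[`|r|]mulr1; apply: nleZ; [rewrite norm_realC|exact: nle1]. Qed.
Lemma nle_rscalM r x s : 0 <= r -> nle x s -> nle (rscal r * x) (r * s).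
Proof. by move=> r0 xs; rewrite -{2}(ger0_norm r0); apply: nleM => //; exact: nle_rscal. Qed.
Lemma nleN x r : nle x r -> nle (- x) r.
Proof.
by rewrite -scaleN1r => xr; rewrite -[r]mul1r; apply: nleZ => //; rewrite normrN1.
Qed.
Lemma nleB x y r s : nle x r -> nle y s -> nle (x - y) (r + s).
Proof. by move=> xr ys; apply: nleD => //; exact: nleN. Qed.
Lemma nle0 r : 0 <= r -> nle (0 : B) r.
Proof.
move=> r0; apply: (@nleW _ _ _ `|0|); first by rewrite normr0.
by rewrite -rscal0; exact: nle_rscal.
Qed.
Lemma nle_exgt0 x : exists2 r, 0 < r & nle x r.
Proof.
have [r xr] := nle_ex x; exists (r + 1); first by have := nle_ge0 xr; lra.
by apply: nleW xr; rewrite lerDl.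
Qed.
Lemma nle_small x C : (forall e, 0 < e -> nle x (C * e)) -> x = 0.
Proof.
move=> h; apply: nle_eq0; apply: nle_closed => e e0; rewrite add0r.
have C0 : 0 <= C by have := nle_ge0 (h 1 ltr01); rewrite mulr1.
have := h (e / (C + 1)); rewrite divr_gt0 ?ltr_wpDl// => /(_ isT).
apply: nleW; rewrite mulrCA ger_pMr// ler_pdivrMr ?ltr_wpDl//; lra.
Qed.

Definition blim (u : nat -> B) l :=
  forall e, 0 < e -> exists N, forall n, (N <= n)%N -> nle (l - u n) e.

Lemma blim_unique u l l' : blim u l -> blim u l' -> l = l'.
Proof.
move=> ul ul'; apply/eqP; rewrite -subr_eq0; apply/eqP/(@nle_small _ 2) => e e0.
have [N hN] := ul _ e0; have [N' hN'] := ul' _ e0.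
have -> : l - l' = (l - u (maxn N N')) - (l' - u (maxn N N')) by ncring.
rewrite mulr_natl mulr2n; apply: nleB; first by apply: hN; exact: leq_maxl.
by apply: hN'; exact: leq_maxr.
Qed.

Lemma blim_cst x : blim (fun=> x) x.
Proof. by move=> e e0; exists 0%N => n _; rewrite subrr; apply: nle0; exact: ltW. Qed.

Lemma blimD u v l m : blim u l -> blim v m -> blim (fun n => u n + v n) (l + m).
Proof.
move=> ul vm e e0; have e20 : 0 < e / 2 by lra.
have [N hN] := ul _ e20; have [N' hN'] := vm _ e20.
exists (maxn N N') => n; rewrite geq_max => /andP[? ?].
have -> : l + m - (u n + v n) = (l - u n) + (m - v n) by ncring.
by rewrite [e]splitr; apply: nleD; [exact: hN|exact: hN'].
Qed.

Lemma blimM u v l m : blim u l -> blim v m -> blim (fun n => u n * v n) (l * m).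
Proof.
move=> ul vm e e0; have [r r0 lr] := nle_exgt0 l; have [s s0 ms] := nle_exgt0 m.
pose d := Num.min 1 (e / (r + s + 1)).
have d0 : 0 < d by rewrite lt_min ltr01 divr_gt0//; lra.
have d1 : d <= 1 by rewrite ge_min lexx.
have de : (r + s + 1) * d <= e.
  by rewrite mulrC -ler_pdivlMr ?ge_min ?lexx ?orbT//; lra.
have [N hN] := ul _ d0; have [N' hN'] := vm _ d0.
exists (maxn N N') => n; rewrite geq_max => /andP[? ?].
have -> : l * m - u n * v n = (l - u n) * m + l * (m - v n) - (l - u n) * (m - v n).
  by ncring.
apply: (@nleW _ _ _ (d * s + r * d + d * d)); first by nra.
by apply: nleB; [apply: nleD|]; apply: nleM => //; (exact: hN || exact: hN').
Qed.

Lemma blim_star u l : blim u l -> blim (fun n => ustar (u n)) (ustar l).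
Proof.
by move=> ul e /ul[N hN]; exists N => n /hN; rewrite -ustarB; exact: nle_ustar.
Qed.

Lemma blimS u l : blim u l -> blim (fun n => u n.+1) l.
Proof. by move=> ul e /ul[N hN]; exists N => n Nn; apply: hN; exact: leqW. Qed.

Lemma blim_comm u l x : blim u l -> (forall n, u n * x = x * u n) -> l * x = x * l.
Proof.
move=> ul uz; apply: (@blim_unique (fun n => u n * x)).
  by apply: blimM => //; exact: blim_cst.
have -> : (fun n => u n * x) = (fun n => x * u n) by apply/funext.
by apply: blimM => //; exact: blim_cst.
Qed.

Lemma blim_selfadj u l : blim u l -> (forall n, selfadj (u n)) -> selfadj l.
Proof.
move=> ul uz; apply: (@blim_unique (fun n => ustar (u n))); first exact: blim_star.
by have -> : (fun n => ustar (u n)) = u by apply/funext.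
Qed.

Lemma blim_nle u l r : blim u l -> (forall n, nle (u n) r) -> nle l r.
Proof.
move=> ul ur; apply: nle_closed => e e0; have [N /(_ N (leqnn _))] := ul _ e0.
by move=> h; rewrite addrC -[l](subrK (u N)); apply: nleD.
Qed.

Lemma rscal_half x : rscal (1/2) * (x + x) = x.
Proof. by rewrite -mulr2n mulrnAr -mulrnAl -[_ *+ 2]rscalD -splitr rscal1 mul1r. Qed.

(** The equation [(1 - y) ^+ 2 = 1 - t] reads [y = (t + y ^+ 2) / 2].  Iterating
    from [0], the increments are dominated by those of the same real iteration
    with [t = 1], which increases and stays below [1]; this covers the limit case
    of norm exactly [1].  The iterates are polynomials in [t], hence the
    bicommutant clause. *)
Lemma sqrt_one_sub t : selfadj t -> nle t 1 ->
  exists y, [/\ selfadj y, nle y 1, (1 - y) * (1 - y) = 1 - t &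
    forall z, t * z = z * t -> y * z = z * y].
Proof.
move=> tsa t1.
pose u := fun n => iter n (fun y => rscal (1/2) * (t + y * y)) 0.
pose eta : nat -> R := fun n => iter n (fun e => 1/2 * (1 + e * e)) 0.
have uS n : u n.+1 = rscal (1/2) * (t + u n * u n) by [].
have eS n : eta n.+1 = 1/2 * (1 + eta n * eta n) by [].
have e01 n : 0 <= eta n <= 1.
  by elim: n => [|n]; [rewrite /= lexx ler01|rewrite eS; nra].
have usa n : selfadj (u n).
  elim: n => [|n ih]; first exact: selfadj0.
  by rewrite uS; apply: selfadj_rscalM; apply: selfadjD => //; exact: selfadj_sq.
have ucomm z : t * z = z * t -> forall n, u n * z = z * u n.
  move=> tz; elim=> [|n ih]; first by rewrite mul0r mulr0.
  rewrite uS -mulrA mulrDl tz -mulrA ih mulrA ih -mulrA -mulrDr.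
  by rewrite mulrA rscalC -mulrA.
have unle n : nle (u n) (eta n).
  elim: n => [|n ih]; first exact: nle0.
  by rewrite uS eS; apply: nle_rscalM; [lra|apply: nleD => //; exact: nleM].
have ud n : nle (u n.+1 - u n) (eta n.+1 - eta n).
  elim: n => [|n ih].
    rewrite /= !mulr0 !addr0 !subr0; apply: nle_rscalM => //; lra.
  rewrite {1}uS {2}uS {1}eS {2}eS.
  have -> : rscal (1/2) * (t + u n.+1 * u n.+1) - rscal (1/2) * (t + u n * u n) =
    rscal (1/2) * (u n.+1 * (u n.+1 - u n) + (u n.+1 - u n) * u n) by ncring.
  have -> : 1/2 * (1 + eta n.+1 * eta n.+1) - 1/2 * (1 + eta n * eta n) =
    1/2 * (eta n.+1 * (eta n.+1 - eta n) + (eta n.+1 - eta n) * eta n) by ring.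
  by apply: nle_rscalM; [lra|apply: nleD; apply: nleM].
have e1 n : eta n <= 1 by have /andP[] := e01 n.
have [l ul] : exists l, blim u l := nle_complete ud e1.
exists l; split.
- exact: blim_selfadj ul usa.
- by apply: blim_nle ul _ => n; exact: nleW (unle n).
- have : l = rscal (1/2) * (t + l * l).
    apply: blim_unique (blimS ul) _.
    apply: blimM; first exact: blim_cst.
    by apply: blimD; [exact: blim_cst|exact: blimM].
  move=> /(congr1 (fun z => z + z)); rewrite -mulrDr rscal_half => ll.
  have -> : (1 - l) * (1 - l) = 1 - (l + l) + l * l by ncring.
  by rewrite ll; ncring.
- by move=> z /ucomm; exact: blim_comm.
Qed.

(** Neumann series, in the form of the iteration [y := 1 + (1 - d) * y]; its
    increments are dominated by those of the geometric series of [q]. *)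
Lemma neumann d q : q < 1 -> nle (1 - d) q ->
  exists v, [/\ d * v = 1, v * d = 1 & forall z, d * z = z * d -> v * z = z * v].
Proof.
move=> q1 dq; have q0 := nle_ge0 dq.
pose u := fun n => iter n (fun y => 1 + (1 - d) * y) 0.
pose eta : nat -> R := fun n => iter n (fun e => 1 + q * e) 0.
have uS n : u n.+1 = 1 + (1 - d) * u n by [].
have eS n : eta n.+1 = 1 + q * eta n by [].
have ucomm z : d * z = z * d -> forall n, u n * z = z * u n.
  move=> tz; elim=> [|n ih]; first by rewrite mul0r mulr0.
  rewrite uS mulrDl mulrDr mul1r mulr1 -mulrA ih !mulrA.
  by rewrite mulrBl mulrBr mulr1 mul1r tz.
have ud n : nle (u n.+1 - u n) (eta n.+1 - eta n).
  elim: n => [|n ih].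
    by rewrite /= !mulr0 !addr0 !subr0; exact: nle1.
  rewrite {1}uS {2}uS {1}eS {2}eS.
  have -> : 1 + (1 - d) * u n.+1 - (1 + (1 - d) * u n) = (1 - d) * (u n.+1 - u n).
    by ncring.
  have -> : 1 + q * eta n.+1 - (1 + q * eta n) = q * (eta n.+1 - eta n) by ring.
  exact: nleM.
have ee n : 0 <= eta n <= (1 - q)^-1.
  have iq0 : 0 < (1 - q)^-1 by rewrite invr_gt0; lra.
  have iq : (1 - q)^-1 = 1 + q * (1 - q)^-1 by field; lra.
  elim: n => [|n /andP[e0 e1]]; first by rewrite lexx /= ltW.
  by rewrite eS iq; apply/andP; split; [nra|rewrite lerD2l ler_wpM2l].
have e1 n : eta n <= (1 - q)^-1 by have /andP[] := ee n.
have [l ul] : exists l, blim u l := nle_complete ud e1.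
have ll : l = 1 + (1 - d) * l.
  apply: blim_unique (blimS ul) _.
  apply: blimD; first exact: blim_cst.
  by apply: blimM => //; exact: blim_cst.
have lcomm z : d * z = z * d -> l * z = z * l by move=> /ucomm; exact: blim_comm.
have dl : d * l = 1.
  have -> : d * l = l - (1 - d) * l by ncring.
  by rewrite {1}ll; ncring.
by exists l; split => //; rewrite lcomm.
Qed.

(** Under these hypotheses [w + i v] and [w - i v] are unitary, hence of norm at
    most [1], and [w] is their mean.  This turns identities between squares
    into bounds of norms. *)
Lemma unitary_nle w v : selfadj w -> selfadj v -> w * v = v * w -> w * w + v * v = 1 -> nle w 1.
Proof.
move=> wsa vsa wv wv1.
have key (j : R[i]) : (j^*)%R = - j -> j ^+ 2 = -1 -> nle (w + j *: v) 1.
  move=> jc j2; apply: nle_sq => //; rewrite expr1n.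
  have -> : ustar (w + j *: v) * (w + j *: v) = w * w + v * v.
    rewrite ustarD ustarZ wsa vsa jc mulrDl !mulrDr -!scalerAr -!scalerAl scalerA.
    rewrite mulrN -(expr2 j) j2 opprK scale1r scaleNr wv.
    by rewrite addrA addrK.
  by rewrite wv1; exact: nle1.
have e : w = rscal (1/2) * ((w + 'i *: v) + (w + (- 'i) *: v)).
  by rewrite scaleNr addrACA subrr addr0 rscal_half.
rewrite e; apply: (@nleW _ _ _ (1/2 * (1 + 1))); first lra.
apply: nle_rscalM; first lra.
apply: nleD; apply: key.
- exact: conjCi.
- exact: sqrCi.
- by rewrite rmorphN /= conjCi.
- by rewrite sqrrN sqrCi.
Qed.

End UnitalCStar.

(** * Positive elements and the Kelley-Vaught theorem *)

Section Positive.
Variables (R : realType) (B : unitalCStarType R).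
Implicit Types (x y z w t c : B) (r s M : R).
Local Notation rscal := (@rscal R B).

(** Positivity as being the square of a self-adjoint element.  The root is taken
    in the bicommutant of [x], so that roots of commuting elements commute. *)
Definition pos x :=
  exists w, [/\ selfadj w, x = w * w & forall z, x * z = z * x -> w * z = z * w].

Lemma pos_selfadj x : pos x -> selfadj x.
Proof. by move=> [w [wsa -> _]]; exact: selfadj_sq. Qed.

Lemma pos_sub1 t : selfadj t -> nle t 1 -> pos (1 - t).
Proof.
move=> tsa t1; have [y [ysa y1 yy yc]] := sqrt_one_sub tsa t1.
exists (1 - y); split=> //; first by apply: selfadjB => //; exact: selfadj1.
move=> z tz; rewrite mulrBl mulrBr mul1r mulr1 yc//.
by move: tz; rewrite mulrBl mulrBr mul1r mulr1 => /addrI/oppr_inj.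
Qed.

Lemma rscalMM r s x : rscal r * (rscal s * x) = rscal (r * s) * x.
Proof. by rewrite mulrA -rscalM. Qed.

Lemma rscalV r x : r != 0 -> rscal r * (rscal r^-1 * x) = x.
Proof. by move=> r0; rewrite rscalMM divff// rscal1 mul1r. Qed.

Lemma rscal_mulACA r s x y : (rscal r * x) * (rscal s * y) = rscal (r * s) * (x * y).
Proof. by rewrite -mulrA (mulrA x) -(rscalC s x) -!mulrA rscalMM. Qed.

Lemma rscal_inj r x y : r != 0 -> rscal r * x = rscal r * y -> x = y.
Proof.
by move=> r0 /(congr1 ( *%R (rscal r^-1))); rewrite !rscalMM mulVf// rscal1 !mul1r.
Qed.

Lemma rscal_commute r x z : r != 0 -> rscal r * x * z = z * (rscal r * x) -> x * z = z * x.
Proof. by move=> r0; rewrite -mulrA (mulrA z) -rscalC -mulrA; apply: rscal_inj. Qed.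

Lemma commute_rscal r x z : x * z = z * x -> rscal r * x * z = z * (rscal r * x).
Proof. by move=> h; rewrite -mulrA h (mulrA z) -rscalC -mulrA. Qed.

Lemma pos0 : pos 0.
Proof. by exists 0; split; [exact: selfadj0|rewrite mulr0|]. Qed.

Lemma pos_rscalM r x : 0 <= r -> pos x -> pos (rscal r * x).
Proof.
rewrite le_eqVlt => /predU1P[<- _|r0 [w [wsa xw wc]]].
  by rewrite rscal0 mul0r; exact: pos0.
exists (rscal (Num.sqrt r) * w); split; first exact: selfadj_rscalM.
  by rewrite rscal_mulACA -xw -expr2 sqr_sqrtr// ltW.
move=> z /rscal_commute; rewrite gt_eqF// => /(_ isT) /wc; exact: commute_rscal.
Qed.

Lemma pos_of_rscalM r x : 0 < r -> pos (rscal r * x) -> pos x.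
Proof.
move=> r0 /(@pos_rscalM r^-1); rewrite invr_ge0 ltW// => /(_ isT).
by rewrite rscalMM mulVf ?gt_eqF// rscal1 mul1r.
Qed.

Lemma nle_of_rscalM r x s : 0 < r -> nle (rscal r * x) (r * s) -> nle x s.
Proof.
move=> r0 /(@nle_rscalM _ _ r^-1); rewrite invr_ge0 ltW// => /(_ isT).
by rewrite rscalMM mulrA mulVf ?gt_eqF// rscal1 !mul1r.
Qed.

Lemma rscal_sub r x : r != 0 -> rscal r - x = rscal r * (1 - rscal r^-1 * x).
Proof. by move=> r0; rewrite mulrBr mulr1 rscalV. Qed.

Lemma pos_sub r x : selfadj x -> nle x r -> 0 < r -> pos (rscal r - x).
Proof.
move=> xsa xr r0; rewrite rscal_sub ?gt_eqF//; apply: pos_rscalM; first exact: ltW.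
apply: pos_sub1; first exact: selfadj_rscalM.
apply: (@nle_of_rscalM r) => //; rewrite rscalV ?gt_eqF// mulr1//.
Qed.

(** With [pos_sub_nle] this describes positivity by the norm: [x] is positive as
    soon as its distance to [r] is at most [r].  That is a convex condition, which
    is why sums of positive elements are positive. *)
Lemma pos_of_nle r x : selfadj x -> 0 < r -> nle (rscal r - x) r -> pos x.
Proof.
move=> xsa r0 h; have := pos_sub (selfadjB (selfadj_rscal B r) xsa) h r0.
by rewrite opprB addrCA subrr addr0.
Qed.

(** A root [1 - y] of [1 - w * w] commutes with [w], and the two squares have sum
    [1], so that [unitary_nle] bounds this root. *)
Lemma sq_sub_nle1 w : selfadj w -> nle (w * w) 1 -> nle (1 - w * w) 1.
Proof.
move=> wsa w1; have [y [ysa y1 yy yc]] := sqrt_one_sub (selfadj_sq wsa) w1.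
have s1 : nle (1 - y) 1.
  apply: (@unitary_nle _ _ _ w) => //.
  - by apply: selfadjB => //; exact: selfadj1.
  - by rewrite mulrBl mulrBr mul1r mulr1 yc// mulrA.
  - by rewrite yy subrK.
by rewrite -yy -[1 in X in nle _ X]mulr1; apply: nleM.
Qed.

Lemma sq_sub_nle r w : 0 < r -> selfadj w -> nle (w * w) r -> nle (rscal r - w * w) r.
Proof.
move=> r0 wsa w1; rewrite rscal_sub ?gt_eqF//.
apply: (@nleW _ _ _ (r * 1)); first by rewrite mulr1.
apply: nle_rscalM; first exact: ltW.
have e : rscal r^-1 * (w * w) = (rscal (Num.sqrt r^-1) * w) * (rscal (Num.sqrt r^-1) * w).
  by rewrite rscal_mulACA -(expr2 (Num.sqrt _)) sqr_sqrtr// invr_ge0 ltW.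
have : nle (rscal r^-1 * (w * w)) 1.
  by apply: (@nle_of_rscalM r) => //; rewrite rscalV ?gt_eqF// mulr1.
rewrite e; apply: sq_sub_nle1; exact: selfadj_rscalM.
Qed.

Lemma pos_sq w : selfadj w -> pos (w * w).
Proof.
move=> wsa; have [r r0 wr] := nle_exgt0 (w * w).
by apply: (@pos_of_nle r) => //; [exact: selfadj_sq|exact: sq_sub_nle].
Qed.

Lemma pos_rscal r : 0 <= r -> pos (rscal r).
Proof.
move=> r0; rewrite -[r]sqr_sqrtr// expr2 rscalM; apply: pos_sq; exact: selfadj_rscal.
Qed.

Lemma pos_sub_nle r x : 0 < r -> pos x -> nle x r -> nle (rscal r - x) r.
Proof. by move=> r0 [w [wsa -> _]]; exact: sq_sub_nle. Qed.

Lemma posD x y : pos x -> pos y -> pos (x + y).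
Proof.
move=> px py; have [r r0 xr] := nle_exgt0 x; have [s s0 ys] := nle_exgt0 y.
apply: (@pos_of_nle (r + s)); [by apply: selfadjD; exact: pos_selfadj|lra|].
rewrite rscalD opprD addrACA; apply: nleD; exact: pos_sub_nle.
Qed.

(** The commuting roots of [x] and [1 - x] have squares of sum [1]. *)
Lemma pos_nle1 x : pos x -> pos (1 - x) -> nle x 1.
Proof.
move=> [w [wsa xw wc]] [v [vsa xv vc]].
have xw' : x * w = w * x by rewrite xw mulrA.
have vw : v * w = w * v by apply: vc; rewrite mulrBl mulrBr mul1r mulr1 xw'.
have w1 : nle w 1.
  by apply: (@unitary_nle _ _ _ v) => //; rewrite -xw -xv addrC subrK.
by rewrite xw; apply: (@nleW _ _ _ (1 * 1)); [rewrite mulr1|apply: nleM].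
Qed.

Lemma pos_nle_gt0 r x : 0 < r -> pos x -> pos (rscal r - x) -> nle x r.
Proof.
move=> r0 px; rewrite rscal_sub ?gt_eqF// => /(pos_of_rscalM r0) h.
rewrite -[x](@rscalV r) ?gt_eqF//; apply: (@nleW _ _ _ (r * 1)); first by rewrite mulr1.
apply: nle_rscalM; first exact: ltW.
by apply: pos_nle1 => //; apply: pos_rscalM => //; rewrite invr_ge0 ltW.
Qed.

Lemma pos_nle r x : 0 <= r -> pos x -> pos (rscal r - x) -> nle x r.
Proof.
move=> r0 px h; apply: nle_closed => e e0; apply: pos_nle_gt0 => //; first lra.
by rewrite rscalD addrAC; apply: posD => //; apply: pos_rscal; exact: ltW.
Qed.

Lemma nle_pos r x : selfadj x -> nle x r -> pos (rscal r - x).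
Proof.
move=> xsa xr; have := nle_ge0 xr; rewrite le_eqVlt => /predU1P[r0|]; last exact: pos_sub.
by move: xr; rewrite -r0 => /nle_eq0 ->; rewrite rscal0 subrr; exact: pos0.
Qed.

Lemma selfadj_mul0 x : selfadj x -> x * x = 0 -> x = 0.
Proof.
move=> xsa x0; apply: nle_eq0; apply: nle_sq => //.
by rewrite xsa x0; apply: nle0; exact: sqr_ge0.
Qed.

Lemma star_mul_nle c r : 0 <= r -> nle (ustar c * c) r -> nle (c * ustar c) r.
Proof.
move=> r0 h; have cr : nle c (Num.sqrt r) by apply: nle_sq; rewrite ?sqrtr_ge0 ?sqr_sqrtr.
by rewrite -[r]sqr_sqrtr// expr2; apply: nleM => //; exact: nle_ustar.
Qed.

(** The interval from [0] to [M] has radius [M / 2] about its midpoint: with roots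
    [w] of [x] and [v] of [M - x], the squares of [M / 2 - x] and of [v * w] have sum
    [(M / 2) ^+ 2]. *)
Lemma half_sub_nle M x : 0 < M -> pos x -> nle x M -> nle (rscal (M / 2) - x) (M / 2).
Proof.
move=> M0 px xM; have := pos_sub (pos_selfadj px) xM M0.
case: (px) => w [wsa xw wc] [v [vsa xv vc]].
have xw' : x * w = w * x by rewrite xw mulrA.
have vw : v * w = w * v by apply: vc; rewrite mulrBl mulrBr xw' rscalC.
have vw2 : (v * w) * (v * w) = rscal M * x - x * x.
  have -> : v * w * (v * w) = w * (v * v) * w by rewrite {1}vw !mulrA.
  by rewrite -xv mulrBr mulrBl -rscalC -(mulrA (rscal M)) -xw -xw' -mulrA -xw.
have sb := selfadjM vsa wsa vw.
have e : (rscal (M / 2) - x) * (rscal (M / 2) - x) = rscal ((M / 2) ^+ 2) - v * w * (v * w).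
  rewrite vw2 mulrBl !mulrBr -(rscalC _ x) opprB.
  have -> : rscal M = rscal (M/2) + rscal (M/2) by rewrite -rscalD -splitr.
  by rewrite expr2 (rscalM _ (M / 2) (M / 2)); ncring.
have dsa : selfadj (rscal (M / 2) - x) by apply: selfadjB; [exact: selfadj_rscal|exact: pos_selfadj].
apply: nle_sq; first lra.
rewrite dsa; apply: pos_nle; [exact: sqr_ge0|exact: pos_sq|].
by rewrite e opprB addrCA subrr addr0; exact: pos_sq.
Qed.

(** The products [star c * c] and [c * star c] have the same bounds [M].  Since
    [c * star c] lies between [0] and [M], its distance to [M / 2] is at most [M / 2];
    conjugating by [c] bounds [(M / 2) * z ^+ 2 + z ^+ 4] by [M ^+ 2 / 2].  Hence
    [z ^+ 4] has the same bound, so the bound [M] of [z ^+ 2] improves to [M] over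
    the square root of [2], and this repeats. *)
Lemma kelley_vaught_key z c : selfadj z -> ustar c * c = - (z * z) -> pos (c * ustar c) ->
  z = 0.
Proof.
move=> zsa cz pc.
have zz : selfadj (z * z) by exact: selfadj_sq.
(* The factor 3/4 is a rational number whose square exceeds 1/2. *)
have key M : 0 < M -> nle (z * z) M -> nle (z * z) (3/4 * M).
  move=> M0 zM.
  have cM : nle (ustar c * c) M by rewrite cz; exact: nleN.
  have cr : nle c (Num.sqrt M).
    by apply: nle_sq; rewrite ?sqrtr_ge0 ?sqr_sqrtr// ltW.
  have h := half_sub_nle M0 pc (star_mul_nle (ltW M0) cM).
  have : nle (ustar c * (rscal (M / 2) - c * ustar c) * c) (M * (M / 2)).
    have -> : M * (M / 2) = Num.sqrt M * (M / 2) * Num.sqrt M.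
      by rewrite mulrAC -expr2 sqr_sqrtr// ltW.
    by apply: nleM => //; apply: nleM => //; exact: nle_ustar.
  have -> : ustar c * (rscal (M / 2) - c * ustar c) * c =
      - (rscal (M / 2) * (z * z) + (z * z) * (z * z)).
    have -> : ustar c * (rscal (M / 2) - c * ustar c) * c =
        rscal (M / 2) * (ustar c * c) - (ustar c * c) * (ustar c * c).
      by rewrite mulrBr mulrBl -rscalC !mulrA.
    by rewrite cz mulrN mulrNN opprD.
  move=> /nleN; rewrite opprK => hb.
  have pz := pos_sq zsa.
  have pM : pos (rscal (M / 2) * (z * z)) by apply: pos_rscalM => //; lra.
  apply: nle_sq; first lra.
  rewrite zz; apply: pos_nle; [exact: sqr_ge0|exact: pos_sq|].
  have := posD pM (nle_pos (selfadjD (pos_selfadj pM) (pos_selfadj (pos_sq zz))) hb).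
  rewrite opprD addrCA (addrA _ (- _)) subrr add0r => hp.
  have -> : rscal ((3/4 * M) ^+ 2) = rscal (M * (M / 2)) + rscal (1/16 * M ^+ 2).
    by rewrite -rscalD; congr rscal; field.
  by rewrite addrAC; apply: posD => //; apply: pos_rscal; apply: mulr_ge0; [lra|exact: sqr_ge0].
apply: selfadj_mul0 => //; have [M M0 zM] := nle_exgt0 (z * z).
have hn n : nle (z * z) ((3/4) ^+ n * M).
  elim: n => [|n ih]; first by rewrite mul1r.
  by rewrite exprS -mulrA; apply: key => //; apply: mulr_gt0 => //; apply: exprn_gt0; lra.
apply: nle_eq0; apply: nle_closed => e e0; rewrite add0r.
have : (fun n => (3/4 : R) ^+ n * M) @ \oo --> 0 * M.
  apply: cvgM; last exact: cvg_cst.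
  by apply: cvg_expr; rewrite ger0_norm; lra.
rewrite mul0r => /cvgr0Pnorm_lt /(_ e e0)[N _ /(_ N (leqnn _))] /= h.
by apply: nleW (hn N); apply: le_trans (ltW h); exact: ler_norm.
Qed.

(** This is twice the sum of the squares of the real and imaginary parts of [c]. *)
Lemma pos_add_star c : pos (ustar c * c + c * ustar c).
Proof.
have a1 : selfadj (c + ustar c) by rewrite /selfadj ustarD ustarK addrC.
have a2 : selfadj ('i *: (c - ustar c)).
  by rewrite /selfadj ustarZ ustarB ustarK conjCi scaleNr -scalerN opprB.
have : pos (rscal (1/2) * ((c + ustar c) * (c + ustar c) +
                 'i *: (c - ustar c) * ('i *: (c - ustar c)))).
  by apply: pos_rscalM; [lra|apply: posD; exact: pos_sq].
rewrite -(scalerAl 'i) -(scalerAr 'i) scalerA -(expr2 'i) sqrCi scaleN1r.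
have -> : (c + ustar c) * (c + ustar c) - (c - ustar c) * (c - ustar c) =
  (ustar c * c + c * ustar c) + (ustar c * c + c * ustar c) by ncring.
by rewrite rscal_half.
Qed.

(** The Kelley-Vaught theorem.  Let [h] be [star t * t], let [k] be its absolute
    value, that is the positive root of [h * h], and let [n := k - h], twice the
    negative part of [h].  Then [c := t * n] satisfies
    [star c * c = n * h * n = - n * k * n], minus a square, whereas [pos_add_star]
    makes [c * star c] positive.  By [kelley_vaught_key] this square vanishes, so
    [n = 0] and [h = k]. *)
Lemma pos_star t : pos (ustar t * t).
Proof.
have hsa := selfadj_star t; set h := ustar t * t in hsa *.
have [r r0 hr] := nle_exgt0 h.
have isa : selfadj (rscal r^-1 * h) by exact: selfadj_rscalM.
have ib : nle (rscal r^-1 * h) 1.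
  by apply: (@nle_of_rscalM r) => //; rewrite rscalV ?gt_eqF// mulr1.
have hb : nle (1 - rscal r^-1 * h * (rscal r^-1 * h)) 1.
  by apply: sq_sub_nle1 => //; apply: (@nleW _ _ _ (1 * 1)); [rewrite mulr1|exact: nleM].
have := sqrt_one_sub (selfadjB (selfadj1 B) (selfadj_sq isa)) hb.
move=> [y [ysa y1 yy yc]].
pose k := rscal r * (1 - y).
have kk : k * k = h * h.
  rewrite rscal_mulACA yy opprB addrCA subrr addr0 rscal_mulACA rscalMM.
  have -> : r * r * (r^-1 * r^-1) = 1 by field; rewrite gt_eqF.
  by rewrite rscal1 mul1r.
have kh : k * h = h * k.
  apply: commute_rscal; rewrite mulrBl mulrBr mul1r mulr1 yc//.
  rewrite mulrBl mulrBr mul1r mulr1; congr (_ - _).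
  by rewrite rscal_mulACA; apply: commute_rscal; rewrite mulrA.
have pk : pos k by apply: pos_rscalM; [exact: ltW|exact: pos_sub1].
case: (pk) => w [wsa kw wc].
pose n := k - h.
have nsa : selfadj n by apply: selfadjB => //; exact: pos_selfadj.
have kn : k * n = n * k by rewrite /n mulrBl mulrBr kh.
have wn := wc _ kn.
(* The product of k - h and k + h vanishes because k and h commute and have the same square. *)
have hn : h * n = - (k * n) by rewrite /n !mulrBr -kh kk opprB.
have nwwn : n * (w * w * n) = w * n * (w * n) by rewrite {1}wn !mulrA.
have e : w * n = 0.
  apply: (@kelley_vaught_key _ (t * n)).
  - exact: selfadjM.
  - rewrite ustarM nsa mulrA -(mulrA n) -/h -mulrA hn mulrN kw.
    by rewrite nwwn.
  - have := posD (pos_add_star (t * n)) (pos_sq (selfadjM wsa nsa wn)).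
    rewrite addrAC {1}ustarM nsa mulrA -(mulrA n) -/h -mulrA hn mulrN kw.
    by rewrite nwwn addNr add0r.
have kn0 : k * n = 0 by rewrite kw -mulrA e mulr0.
have n0 : n = 0.
  by apply: selfadj_mul0 => //; rewrite {1}/n mulrBl hn kn0 oppr0 subrr.
by move: n0 => /eqP; rewrite subr_eq0 => /eqP <-.
Qed.

Lemma pos_conj c x : pos x -> pos (ustar c * x * c).
Proof.
move=> [w [wsa -> _]].
by have := pos_star (w * c); rewrite ustarM wsa !mulrA.
Qed.

Lemma pos_mulC x y : pos x -> pos y -> x * y = y * x -> pos (x * y).
Proof.
move=> [w [wsa xw wc]] [v [vsa yv vc]] xy.
have vw : v * w = w * v by apply: vc; rewrite wc.
have -> : x * y = (w * v) * (w * v).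
  by rewrite xw yv -(mulrA w v) (mulrA v w) vw !mulrA.
by apply: pos_sq; apply: selfadjM.
Qed.

End Positive.

(** * Real-valued norms and completeness *)

Section RealNorm.
Variables (R : realType) (A : normedModType R[i]).
Implicit Types (x y : A).

(** The order of [R[i]] is only partial, so estimates are carried out in [R]. *)
Definition rnorm x : R := complex.Re `|x|.

Lemma rnormE x : (rnorm x)%:C = `|x|.
Proof. by apply: RRe_real; exact: normr_real. Qed.

Lemma rnorm_le x r : (rnorm x <= r) = (`|x| <= r%:C).
Proof. by rewrite -rnormE lecR. Qed.

Lemma rnorm_ge0 x : 0 <= rnorm x.
Proof. by rewrite -ler0c rnormE. Qed.

Lemma rnorm0 : rnorm (0 : A) = 0. Proof. by rewrite /rnorm normr0. Qed.

Lemma rnorm_eq0 x : rnorm x = 0 -> x = 0.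
Proof. by move=> x0; apply/eqP; rewrite -normr_eq0 -rnormE x0. Qed.

Lemma rnormN x : rnorm (- x) = rnorm x. Proof. by rewrite /rnorm normrN. Qed.

Lemma rnormBC x y : rnorm (x - y) = rnorm (y - x). Proof. by rewrite /rnorm distrC. Qed.

Lemma rnormD x y : rnorm (x + y) <= rnorm x + rnorm y.
Proof. by rewrite rnorm_le rmorphD /= !rnormE ler_normD. Qed.

Lemma rnormB x y : rnorm (x - y) <= rnorm x + rnorm y.
Proof. by rewrite -(rnormN y) rnormD. Qed.

Lemma rnormZ_le (l : R[i]) r x : `|l| <= r%:C -> rnorm (l *: x) <= r * rnorm x.
Proof. by move=> lr; rewrite rnorm_le normrZ rmorphM /= rnormE ler_wpM2r. Qed.

Lemma rnormZ r x : 0 <= r -> rnorm (r%:C *: x) = r * rnorm x.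
Proof.
move=> r0; apply/eqP; rewrite -(inj_eq (@complexI R)) rnormE normrZ norm_realC.
by rewrite ger0_norm// rmorphM /= rnormE.
Qed.

Lemma gt0_realC (e : R[i]) : 0 < e -> exists2 r : R, 0 < r & e = r%:C.
Proof.
move=> e0; exists (complex.Re e); last by rewrite RRe_real// gtr0_real.
by rewrite -ltcR RRe_real// gtr0_real.
Qed.

End RealNorm.

Lemma bounded_nondecreasing_cauchy (R : realType) (eta : nat -> R) K :
  (forall n, eta n <= eta n.+1) -> (forall n, eta n <= K) ->
  forall e, 0 < e -> exists N, forall n, (N <= n)%N -> eta n - eta N <= e.
Proof.
move=> nd b e e0.
have ndh : nondecreasing_seq eta by apply/nondecreasing_seqP.
have cv : cvgn eta.
  by apply: nondecreasing_is_cvgn => //; exists K => _ [n _ <-].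
have /cvgrPdist_le /(_ e e0)[N _ /(_ N (leqnn _)) h] := cv.
exists N => n Nn; have := nondecreasing_cvgn_le ndh cv n.
by move: h => /= /ler_normlP[]; lra.
Qed.

Lemma complete_dominated (R : realType) (A : completeNormedModType R[i])
    (u : nat -> A) (eta : nat -> R) K :
  (forall n, rnorm (u n.+1 - u n) <= eta n.+1 - eta n) -> (forall n, eta n <= K) ->
  exists l, forall e, 0 < e -> exists N, forall n, (N <= n)%N -> rnorm (l - u n) <= e.
Proof.
move=> ue eK.
have nd n : eta n <= eta n.+1 by have := le_trans (rnorm_ge0 _) (ue n); rewrite subr_ge0.
have um N n : (N <= n)%N -> rnorm (u n - u N) <= eta n - eta N.
  move=> /subnK <-; elim: (n - N)%N => [|m ih]; first by rewrite !subrr rnorm0.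
  rewrite addSn -[u _](subrK (u (m + N)%N)) -addrA; apply: le_trans (rnormD _ _) _.
  by have := ue (m + N)%N; lra.
have cu : cauchy (u @ \oo).
  apply: cauchy_exP => _ /gt0_realC[e e0 ->].
  have e20 : 0 < e / 2 by lra.
  have [N hN] := bounded_nondecreasing_cauchy nd eK e20.
  exists (u N); exists N => // n /= Nn; rewrite -ball_normE /= distrC -rnormE ltcR.
  by have := hN _ Nn; have := um _ _ Nn; lra.
have /cvg_ex[l /cvgrPdist_le ul] : cvg (u @ \oo) by exact: cauchy_cvg.
exists l => e e0; have := ul e%:C; rewrite ltcR => /(_ e0)[N _ hN].
by exists N => n /hN /=; rewrite rnorm_le.
Qed.

(** * The unitization of a C*-algebra *)

Section CStarNorm.
Variables (R : realType) (A : cstarAlgType R).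
Implicit Types (x y z : A).

Lemma rnormM x y : rnorm (x ** y) <= rnorm x * rnorm y.
Proof. by rewrite rnorm_le rmorphM /= !rnormE cnormM. Qed.

Lemma rnorm_star_mul x : rnorm (cstar x ** x) = rnorm x ^+ 2.
Proof.
apply/eqP; rewrite -(inj_eq (@complexI R)) rnormE cnorm_star_mul.
by rewrite rmorphXn /= rnormE.
Qed.

Lemma rnorm_star x : rnorm (cstar x) = rnorm x.
Proof.
have le y : rnorm y <= rnorm (cstar y).
  have [->|y0] := eqVneq (rnorm y) 0; first exact: rnorm_ge0.
  have y1 : 0 < rnorm y by rewrite lt_neqAle eq_sym y0 rnorm_ge0.
  by rewrite -(ler_pM2r y1) -expr2 -rnorm_star_mul rnormM.
by apply/eqP; rewrite eq_le le -{2}(cstarK x) le.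
Qed.

Lemma cmul0 x : x ** 0 = 0.
Proof. by apply: (addIr (x ** 0)); rewrite -cmulDr !add0r. Qed.
Lemma cmul0l x : 0 ** x = 0.
Proof. by apply: (addIr (0 ** x)); rewrite -cmulDl !add0r. Qed.
Lemma cmulN x y : x ** (- y) = - (x ** y).
Proof. by apply: (addIr (x ** y)); rewrite -cmulDr !addNr cmul0. Qed.
Lemma cmulNl x y : (- x) ** y = - (x ** y).
Proof. by apply: (addIr (x ** y)); rewrite -cmulDl !addNr cmul0l. Qed.
End CStarNorm.

(** The pair [(l, x)] stands for [l + x].  When [A] is already unital this is the
    algebra sum of [A] and the scalars. *)
Definition unitization (R : realType) (A : cstarAlgType R) : Type := (R[i]^o * A)%type.

Section Unitization.
Variables (R : realType) (A : cstarAlgType R).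
Local Notation U := (unitization A).
HB.instance Definition _ := GRing.Lmodule.copy U (R[i]^o * A)%type.

Implicit Types (p q : U) (x y z : A).

Definition umul p q : U := (p.1 * q.1, p.1 *: q.2 + q.1 *: p.2 + p.2 ** q.2).
Definition uone : U := (1, 0).

Fact umulA : associative umul.
Proof.
move=> [a x] [b y] [c z]; rewrite /umul /=; congr (_, _); first by rewrite mulrA.
rewrite !scalerDr !scalerA !cmulDl !cmulDr !cmulZl !cmulZr !cmulA.
rewrite !addrA (mulrC c a) (mulrC c b).
by rewrite [LHS](ACl (1*2*4*6*3*5*7)).
Qed.
Fact umul1l : left_id uone umul.
Proof.
by move=> [a x]; rewrite /umul /= mul1r scale1r scaler0 addr0 cmul0l addr0.
Qed.
Fact umul1r : right_id uone umul.
Proof.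
by move=> [a x]; rewrite /umul /= mulr1 scale1r scaler0 add0r cmul0 addr0.
Qed.
Fact umulDl : left_distributive umul +%R.
Proof.
move=> [a x] [b y] [c z]; rewrite /umul /=; congr (_, _); first by rewrite mulrDl.
by rewrite /= scalerDl scalerDr cmulDl (addrACA (a *: z)) [LHS]addrACA.
Qed.
Fact umulDr : right_distributive umul +%R.
Proof.
move=> [a x] [b y] [c z]; rewrite /umul /=; congr (_, _); first by rewrite mulrDr.
by rewrite /= scalerDl scalerDr cmulDr (addrACA (a *: y)) [LHS]addrACA.
Qed.
Fact uone_neq0 : uone != 0.
Proof. by apply/eqP => -[] /eqP; rewrite oner_eq0. Qed.

HB.instance Definition _ := GRing.Zmodule_isNzRing.Build U
  umulA umul1l umul1r umulDl umulDr uone_neq0.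

Fact uscaleAl (a : R[i]) p q : a *: (p * q) = (a *: p) * q.
Proof.
case: p q => [b x] [c y]; congr (_, _); first exact: mulrA.
by rewrite /= !scalerDr !scalerA cmulZl (mulrC c).
Qed.
HB.instance Definition _ := GRing.Lmodule_isLalgebra.Build R[i] U uscaleAl.
Fact uscaleAr (a : R[i]) p q : a *: (p * q) = p * (a *: q).
Proof.
case: p q => [b x] [c y]; congr (_, _); first exact: mulrCA.
by rewrite /= !scalerDr !scalerA cmulZr (mulrC b).
Qed.
HB.instance Definition _ := GRing.Lalgebra_isAlgebra.Build R[i] U uscaleAr.

Definition ustr p : U := ((p.1^*)%R, cstar p.2).

Definition act p x : A := p.1 *: x + p.2 ** x.

(** The maximum of the modulus of the scalar part and of the operator norm on [A].
    The first term keeps this a norm, and not only a seminorm, when [A] has a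
    unit. *)
Definition unle p r := `|p.1| <= r%:C /\ forall x, rnorm (act p x) <= r * rnorm x.

Lemma actM p q x : act (p * q) x = act p (act q x).
Proof.
case: p q => [a y] [b z]; rewrite /act /=.
by rewrite cmulDl cmulDl !cmulZl cmulDr cmulZr scalerDr !scalerA cmulA !addrA [_ + b *: _]addrAC.
Qed.
Lemma actD p q x : act (p + q) x = act p x + act q x.
Proof. by rewrite /act /= scalerDl cmulDl addrACA. Qed.
Lemma actZ (l : R[i]) p x : act (l *: p) x = l *: act p x.
Proof. by rewrite /act /= cmulZl scalerDr scalerA. Qed.
Lemma act1 x : act 1 x = x.
Proof. by rewrite /act /= scale1r cmul0l addr0. Qed.
Lemma actr p x y : act p (x ** y) = act p x ** y.
Proof. by rewrite /act cmulDl cmulZl cmulA. Qed.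
(** The action of [p] is adjointable, with adjoint the action of its star, for the
    [A]-valued inner product [cstar x ** y]. *)
Lemma act_star p x y : cstar x ** act p y = cstar (act (ustr p) x) ** y.
Proof.
rewrite /act /= cstarD cstarZ cstarM cstarK cmulDr cmulDl cmulZl cmulZr cmulA.
by rewrite conjCK.
Qed.

Fact ustrK : involutive ustr.
Proof. by move=> [a x]; rewrite /ustr /= conjCK cstarK. Qed.
Fact ustrD : {morph ustr : x y / x + y}.
Proof. by move=> [a x] [b y]; rewrite /ustr /= rmorphD cstarD. Qed.
Fact ustrZ (l : R[i]) p : ustr (l *: p) = (l^*)%R *: ustr p.
Proof. by case: p => a x; rewrite /ustr /= rmorphM cstarZ. Qed.
Fact ustrM p q : ustr (p * q) = ustr q * ustr p.
Proof.
case: p q => a x [b y]; congr (_, _); first by rewrite /= rmorphM mulrC.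
by rewrite /= !cstarD !cstarZ cstarM; congr (_ + _); rewrite addrC.
Qed.

Fact unle_ge0 p r : unle p r -> 0 <= r.
Proof. by move=> [h _]; rewrite -ler0c; apply: le_trans h. Qed.
Fact unleW p r s : r <= s -> unle p r -> unle p s.
Proof.
move=> rscal [h k]; split; first by apply: le_trans h _; rewrite lecR.
by move=> x; apply: le_trans (k x) _; rewrite ler_wpM2r ?rnorm_ge0.
Qed.
Fact unle_ex p : exists r, unle p r.
Proof.
case: p => a x; exists (rnorm (a : R[i]^o) + rnorm x); split => [|y] /=.
  by rewrite rmorphD /= rnormE lerDl ler0c rnorm_ge0.
apply: le_trans (rnormD _ _) _; rewrite mulrDl lerD ?rnormM//.
by apply: rnormZ_le; rewrite rnormE.
Qed.
Fact unle_closed p r : (forall e, 0 < e -> unle p (r + e)) -> unle p r.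
Proof.
move=> h; split.
  rewrite -(rnormE (p.1 : R[i]^o)) lecR; apply/ler_addgt0Pr => e e0.
  by have [] := h _ e0; rewrite -(rnormE (p.1 : R[i]^o)) lecR.
move=> x; apply/ler_addgt0Pr => e e0.
have n0 := rnorm_ge0 x; have d0 : 0 < e / (rnorm x + 1) by apply: divr_gt0; lra.
have [_ /(_ x) hx] := h _ d0; apply: le_trans hx _.
rewrite mulrDl lerD2l mulrAC ler_pdivrMr; last lra.
by rewrite ler_pM2l//; lra.
Qed.
Fact unle_eq0 p : unle p 0 -> p = 0.
Proof.
case: p => a x [/= a0 h].
have {}a0 : a = 0 by apply/eqP; rewrite -normr_le0.
congr (_, _) => //; apply: rnorm_eq0; apply/eqP.
have := h (cstar x); rewrite mul0r /act a0 /= scale0r add0r.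
rewrite -{1}(cstarK x) rnorm_star_mul rnorm_star => h0.
by rewrite -sqrf_eq0 eq_le h0 sqr_ge0.
Qed.
Fact unle1 : unle 1 1.
Proof. by split=> [|x]; [rewrite normr1|rewrite act1 mul1r]. Qed.
Fact unleD p q r s : unle p r -> unle q s -> unle (p + q) (r + s).
Proof.
move=> [h h'] [k k']; split=> [|x].
  by rewrite rmorphD /=; apply: le_trans (ler_normD _ _) _; exact: lerD.
by rewrite actD mulrDl; apply: le_trans (rnormD _ _) _; exact: lerD.
Qed.
Fact unleM p q r s : unle p r -> unle q s -> unle (p * q) (r * s).
Proof.
move=> pr [k k']; have r0 := unle_ge0 pr; case: pr => h h'; split=> [|x].
  by rewrite /= normrM rmorphM /=; apply: ler_pM.
by rewrite actM -mulrA; apply: le_trans (h' _) _; rewrite ler_wpM2l.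
Qed.
Fact unleZ (l : R[i]) p c r : `|l| <= c%:C -> unle p r -> unle (l *: p) (c * r).
Proof.
move=> lc [h h']; have c0 : 0 <= c by rewrite -ler0c; apply: le_trans lc.
split=> [|x].
  by rewrite /= normrM rmorphM /=; apply: ler_pM.
rewrite actZ -mulrA; apply: le_trans (rnormZ_le _ lc) _.
by rewrite ler_wpM2l.
Qed.
Fact unle_star p r : unle p r -> unle (ustr p) r.
Proof.
move=> pr; have r0 := unle_ge0 pr; case: pr => h h'; split=> [|x].
  by rewrite /= norm_conjC.
have [->|y0] := eqVneq (rnorm (act (ustr p) x)) 0; first by rewrite mulr_ge0 ?rnorm_ge0.
have y1 : 0 < rnorm (act (ustr p) x) by rewrite lt_neqAle eq_sym y0 rnorm_ge0.
rewrite -(ler_pM2r y1) -expr2 -rnorm_star_mul -act_star.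
apply: le_trans (rnormM _ _) _; rewrite rnorm_star mulrC mulrAC ler_wpM2r ?rnorm_ge0//.
Qed.
(** The C*-inequality: [p x] has square norm that of [cstar x ** act (ustr p * p) x]. *)
Fact unle_sq p r : 0 <= r -> unle (ustr p * p) (r ^+ 2) -> unle p r.
Proof.
move=> r0 [h h']; split=> [|x].
  move: h; rewrite /= normrM norm_conjC -expr2 rmorphXn /=.
  by rewrite ler_pXn2r// nnegrE ?ler0c.
suff : rnorm (act p x) ^+ 2 <= (r * rnorm x) ^+ 2.
  by rewrite ler_pXn2r// nnegrE ?mulr_ge0 ?rnorm_ge0.
rewrite -rnorm_star_mul -[p in cstar (act p _)]ustrK -act_star -actM.
apply: le_trans (rnormM _ _) _; rewrite rnorm_star exprMn mulrC expr2 mulrA.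
by rewrite ler_wpM2r ?rnorm_ge0// h'.
Qed.
Lemma unle_pair (a : R[i]) x r s : `|a| <= r%:C -> rnorm x <= s -> unle (a, x) (r + s).
Proof.
move=> ar xs; split=> [|y] /=.
  apply: le_trans ar _; rewrite lecR lerDl; apply: le_trans xs; exact: rnorm_ge0.
apply: le_trans (rnormD _ _) _; rewrite mulrDl lerD ?rnormZ_le//.
by apply: le_trans (rnormM _ _) _; rewrite ler_wpM2r ?rnorm_ge0.
Qed.

(** Both [a + x] and the scalar [a] are bounded by [r]; the norm of [x] is recovered
    by letting it act on [cstar x]. *)
Lemma unle_snd p r : unle p r -> rnorm p.2 <= 2 * r.
Proof.
move=> pr; have r0 := unle_ge0 pr; case: pr; case: p => a x /= ar h.
have [->|y0] := eqVneq (rnorm x) 0; first lra.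
have y1 : 0 < rnorm x by rewrite lt_neqAle eq_sym y0 rnorm_ge0.
rewrite -(ler_pM2r y1) -expr2 -(rnorm_star x) -rnorm_star_mul cstarK.
have -> : x ** cstar x = act (a, x) (cstar x) - a *: cstar x by rewrite /act /= addrC addKr.
apply: le_trans (rnormB _ _) _; rewrite -mulrA mulrDl mul1r rnorm_star.
by rewrite lerD// -(rnorm_star x) ?h// rnormZ_le.
Qed.

Lemma unle_inj x r : unle (0, x) r <-> rnorm x <= r.
Proof.
split=> [xr|xr].
  have [->|y0] := eqVneq (rnorm x) 0; first exact: unle_ge0 xr.
  case: xr => _ h.
  have y1 : 0 < rnorm x by rewrite lt_neqAle eq_sym y0 rnorm_ge0.
  rewrite -(ler_pM2r y1) -expr2 -(rnorm_star x) -rnorm_star_mul cstarK.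
  by have := h (cstar x); rewrite /act /= scale0r add0r rnorm_star.
by rewrite -[r]add0r; apply: unle_pair => //; rewrite normr0.
Qed.
End Unitization.

(** The sequence [eta + v] is nondecreasing and bounded, and so is [eta]. *)
Lemma real_dominated (R : realType) (v eta : nat -> R) K :
  (forall n, `|v n.+1 - v n| <= eta n.+1 - eta n) -> (forall n, eta n <= K) ->
  exists l, forall e, 0 < e -> exists N, forall n, (N <= n)%N -> `|l - v n| <= e.
Proof.
move=> ve eK.
have cvg_nd (w : nat -> R) M : (forall n, w n <= w n.+1) -> (forall n, w n <= M) -> cvgn w.
  move=> nd b; apply: nondecreasing_is_cvgn; first exact/nondecreasing_seqP.
  by exists M => _ [n _ <-].
have ce : cvgn eta.
  by apply: (cvg_nd _ K) => // n; have := le_trans (normr_ge0 _) (ve n); lra.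
have cw : cvgn (eta + v).
  apply: (cvg_nd _ (v 0%N - eta 0%N + K + K)) => n.
    by rewrite !fctE; have /ler_normlP[] := ve n; lra.
  rewrite !fctE; have : v n <= v 0%N + eta n - eta 0%N.
    elim: n => [|n ih]; first by lra.
    by have /ler_normlP[] := ve n; lra.
  by have := eK n; lra.
have cv : cvgn v.
  have -> : v = (eta + v) - eta by apply/funext => n; rewrite !fctE addrC addKr.
  exact: is_cvgB.
exists (limn v) => e e0; have /cvgrPdist_le /(_ e e0)[N _ h] := cv.
by exists N => n Nn; exact: h.
Qed.

Section UnitizationComplete.
Variables (R : realType) (A : cstarAlgType R).
Local Notation U := (unitization A).

(** The two components of a dominated sequence are dominated, the real and
    imaginary parts of the scalars separately. *)
Fact unle_complete (u : nat -> U) (eta : nat -> R) K :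
  (forall n, unle (u n.+1 - u n) (eta n.+1 - eta n)) -> (forall n, eta n <= K) ->
  exists l, forall e, 0 < e -> exists N, forall n, (N <= n)%N -> unle (l - u n) e.
Proof.
move=> ue eK.
have cpart (f : R[i] -> R) : {morph f : x y / x - y} ->
    (forall x, `|f x|%:C <= `|x|) ->
    exists l, forall e, 0 < e -> exists N, forall n, (N <= n)%N -> `|l - f (u n).1| <= e.
  move=> fB f1; apply: real_dominated eK => n.
  by rewrite -fB -lecR; apply: le_trans (f1 _) _; have [] := ue n.
have [a ha] : exists l, forall e, 0 < e ->
    exists N, forall n, (N <= n)%N -> `|l - complex.Re (u n).1| <= e.
  apply: (cpart (@complex.Re R)) => [[? ?] [? ?]//|x]; exact: normc_ge_Re.
have [b hb] : exists l, forall e, 0 < e ->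
    exists N, forall n, (N <= n)%N -> `|l - complex.Im (u n).1| <= e.
  apply: (cpart (@complex.Im R)) => [[? ?] [? ?]//|x].
  have -> : complex.Im x = - complex.Re ('i * x) by case: x => ? ? /=; ring.
  rewrite normrN; apply: le_trans (normc_ge_Re _) _.
  by rewrite normrM normCi mul1r.
have [x hx] : exists l, forall e, 0 < e ->
    exists N, forall n, (N <= n)%N -> rnorm (l - (u n).2) <= e.
  apply: (@complete_dominated _ _ _ (fun n => 2 * eta n) (2 * K)) => n.
    by rewrite -mulrBr; exact: (unle_snd (ue n)).
  by have := eK n; lra.
exists (a +i* b, x) => e e0; have e30 : 0 < e / 3 by lra.
have [N1 h1] := ha _ e30; have [N2 h2] := hb _ e30; have [N3 h3] := hx _ e30.
exists (maxn N1 (maxn N2 N3)) => n; rewrite !geq_max => /and3P[l1 l2 l3].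
have -> : e = (e / 3 + e / 3) + e / 3 by field.
apply: unle_pair => /=; last exact: h3.
have := h1 _ l1; have := h2 _ l2; case: (u n) => [[c d] y] /= h h'.
have -> : ((a +i* b) - (c +i* d))%C = (a - c)%:C + 'i * (b - d)%:C :> R[i].
  by apply/eqP; rewrite eq_complex /=; apply/andP; split; apply/eqP; ring.
apply: le_trans (ler_normD _ _) _.
by rewrite normrM normCi mul1r !norm_realC -rmorphD /= lecR lerD.
Qed.

HB.instance Definition _ := Algebra_isUnitalCStar.Build R U
  (@ustrK R A) (@ustrD R A) (@ustrZ R A) (@ustrM R A) (@unle_ge0 R A) (@unleW R A)
  (@unle_ex R A) (@unle_closed R A) (@unle_eq0 R A) (@unle1 R A) (@unleD R A) (@unleM R A)
  (@unleZ R A) (@unle_star R A) (@unle_sq R A) unle_complete.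

End UnitizationComplete.

(** * Consequences of positivity *)

Section Interval.
Variables (R : realType) (B : unitalCStarType R).
Implicit Types (x y z w t c e f g v : B) (r s M : R).
Local Notation rscal := (@rscal R B).

Lemma selfadjX x n : selfadj x -> selfadj (x ^+ n).
Proof.
move=> xsa; elim: n => [|n ih]; first exact: selfadj1.
by rewrite exprS; apply: selfadjM => //; exact: commrX.
Qed.

Lemma nle1X x n : nle x 1 -> nle (x ^+ n) 1.
Proof.
move=> x1; elim: n => [|n ih]; first exact: nle1.
by rewrite exprS; apply: (@nleW _ _ _ (1 * 1)); [rewrite mulr1|exact: nleM].
Qed.

Lemma posX x n : pos x -> pos (x ^+ n).
Proof.
move=> px; elim: n => [|n ih]; first by rewrite expr0 -rscal1; exact: pos_rscal.
by rewrite exprS; apply: pos_mulC => //; exact: commrX.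
Qed.

Lemma pos_sub1X f n : pos f -> nle f 1 -> pos (1 - f ^+ n).
Proof. by move=> pf f1; apply: pos_sub1; [apply/selfadjX/pos_selfadj|exact: nle1X]. Qed.

(** On the unit interval [n * e * (1 - e) ^+ n] is at most the sum of the terms
    [e * (1 - e) ^+ j] over [j < n], which telescopes to [1 - (1 - e) ^+ n].  The
    induction [key] keeps track of the difference as a positive element. *)
Lemma spectral_gap e f n : pos e -> pos f -> e + f = 1 -> e * f = f * e ->
  nle (e * f ^+ n.+1) n.+1%:R^-1.
Proof.
move=> pe pf ef1 ef.
have efn m : e * f ^+ m = f ^+ m * e by exact: commrX.
have key m : pos (1 - f ^+ m - rscal m%:R * (e * f ^+ m)).
  elim: m => [|m ih].
    by rewrite expr0 subrr rscal0 mul0r subr0; exact: pos0.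
  have h : pos (rscal m.+1%:R * (e * (e * f ^+ m))).
    apply: pos_rscalM => //; apply: pos_mulC => //.
      by apply: pos_mulC => //; exact: posX.
    by rewrite {1}efn mulrA.
  have := posD ih h; congr pos.
  have e1 : e = 1 - f by rewrite -ef1 addrK.
  rewrite -natr1 rscalD rscal1 exprS e1; ncring.
have p : pos (e * f ^+ n.+1) by apply: pos_mulC => //; exact: posX.
apply: (@nle_of_rscalM _ _ n.+1%:R) => //; rewrite divff ?pnatr_eq0//.
apply: pos_nle1; first exact: pos_rscalM.
by have := posD (key n.+1) (posX n.+1 pf); rewrite addrAC subrK.
Qed.

Lemma nle_root e k r : selfadj e -> r < 1 -> nle (e ^+ (2 ^ k)) r -> exists2 q, q < 1 & nle e q.
Proof.
move=> esa; elim: k r => [|k ih] r r1; first by rewrite expn0 expr1; exists r.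
move=> h; have r0 := nle_ge0 h; apply: (ih (Num.sqrt r)).
  by rewrite -sqrtr1 ltr_sqrt.
apply: nle_sq; first exact: sqrtr_ge0.
by rewrite (selfadjX _ esa) sqr_sqrtr// -exprD addnn -mul2n -expnS.
Qed.

(** After division by [s + r], with [s] a bound of [g], the element [g + r] is at
    distance at most [s / (s + r) < 1] from [1]. *)
Lemma inv_pos_add g r : pos g -> 0 < r -> exists v,
  [/\ (g + rscal r) * v = 1, pos v & g * v = v * g].
Proof.
move=> pg r0; have [s s0 gs] := nle_exgt0 g.
set d := g + rscal r; have d0 : 0 < s + r by lra.
have hb : nle (1 - rscal (s + r)^-1 * d) (s / (s + r)).
  apply: (@nle_of_rscalM _ _ (s + r)) => //.
  rewrite mulrBr rscalV ?gt_eqF// mulr1 mulrCA divff ?gt_eqF// mulr1.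
  by rewrite /d rscalD opprD addrACA subrr addr0; exact: pos_sub_nle.
have [|v [dv vd vc]] := neumann _ hb; first by rewrite ltr_pdivrMr//; lra.
have dV : d * (rscal (s + r)^-1 * v) = 1 by rewrite mulrA -rscalC.
have Vd : (rscal (s + r)^-1 * v) * d = 1 by rewrite rscalC -mulrA.
set V := rscal (s + r)^-1 * v in dV Vd.
have dsa : selfadj d by apply: selfadjD; [exact: pos_selfadj|exact: selfadj_rscal].
have Vsa : selfadj V.
  rewrite /selfadj -[LHS]mulr1 -dV mulrA.
  by rewrite -{1}dsa -ustarM dV ustar1 mul1r.
exists V; split => //.
  have -> : V = ustar V * d * V by rewrite Vsa Vd mul1r.
  by apply: pos_conj; apply: posD => //; apply: pos_rscal; exact: ltW.
have -> : g = d - rscal r by rewrite addrK.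
by rewrite mulrBl mulrBr dV Vd rscalC.
Qed.

(** The row [(g, v)] is a contraction: completing it to a rotation matrix of
    commuting entries, the difference is the square of the other coordinate
    [v * x - g * y]. *)
Lemma pos_rotation g v x y : selfadj g -> selfadj v -> g * v = v * g -> g * g + v * v = 1 ->
  pos (ustar x * x + ustar y * y - ustar (g * x + v * y) * (g * x + v * y)).
Proof.
move=> gsa vsa gv gv1.
have := pos_star (v * x - g * y); congr pos.
apply/eqP; rewrite eq_sym subr_eq; apply/eqP.
rewrite ustarB ustarD !ustarM gsa vsa.
transitivity (ustar x * (g * g + v * v) * x + ustar y * (g * g + v * v) * y).
  by rewrite gv1 !mulr1.
apply/eqP; rewrite -subr_eq0; apply/eqP.
transitivity (ustar x * (v * g - g * v) * y + ustar y * (g * v - v * g) * x).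
  by ncring.
by rewrite gv subrr !mulr0 !mul0r addr0.
Qed.

(** Given [x] whose part [g * x] already has norm at most the square root of [r],
    the other part [v * x] is shrunk by a right factor [1 - c] so that the whole
    gets that norm.  With [m] the square of [g * x] and [D := r + d - m], the square
    [k] of [v * x] is at most [D].  The choice [c := d / D] makes
    [1 - c = (r - m) / D]; then [m + (1 - c) ^+ 2 * D] is at most [r], while the
    modification [v * x * c] has square at most [c ^+ 2 * D = d * c], hence at
    most [d]. *)
Lemma truncation g v x r d :
  selfadj g -> selfadj v -> g * v = v * g -> g * g + v * v = 1 -> 0 <= r -> 0 < d ->
  nle (g * x) (Num.sqrt r) -> nle x (Num.sqrt (r + d)) -> exists c,
  nle (v * (v * x * c)) (Num.sqrt d) /\ nle (x - v * (v * x * c)) (Num.sqrt r).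
Proof.
move=> gsa vsa gv gv1 r0 d0 gxr xrd.
pose m := ustar (g * x) * (g * x).
have mr : nle m r.
  by rewrite -[r]sqr_sqrtr// expr2; apply: nleM => //; exact: nle_ustar.
pose G := rscal r - m.
have pG : pos G by apply: nle_pos => //; exact: selfadj_star.
have [V [DV pV GV]] := inv_pos_add pG d0.
set D := G + rscal d in DV.
have Vsa := pos_selfadj pV.
pose k := ustar (v * x) * (v * x).
(* D - k is r + d minus the square of x, because the squares of g and v have sum 1. *)
have pDk : pos (D - k).
  have : pos (rscal (r + d) - ustar x * x).
    apply: nle_pos; first exact: selfadj_star.
    rewrite -[r + d]sqr_sqrtr ?expr2; last lra.
    by apply: nleM => //; exact: nle_ustar.
  have xx : ustar x * x = ustar x * (g * g + v * v) * x by rewrite gv1 mulr1.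
  by congr pos; rewrite xx /D /G /m /k !ustarM gsa vsa rscalD; ncring.
pose c := rscal d * V.
have csa : selfadj c by exact: selfadj_rscalM.
(* V is the inverse of D = G + d. *)
have e1 : 1 - c = V * G.
  rewrite /c -DV -GV /D; rewrite mulrDl; ncring.
exists c.
have v1 : nle v 1.
  by apply: (@unitary_nle _ _ _ g) => //; rewrite addrC.
have pk : pos (c * (D - k) * c) by rewrite -{1}csa; exact: pos_conj.
have pVG : pos (c * G).
  by rewrite -mulrA; apply: pos_rscalM; [exact: ltW|exact: pos_mulC].
have cD : D * c = rscal d by rewrite /c mulrA -rscalC -mulrA DV mulr1.
split.
  apply: (@nleW _ _ _ (1 * Num.sqrt d)); first by rewrite mul1r.
  apply: nleM => //; apply: nle_sq; first exact: sqrtr_ge0.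
  rewrite sqr_sqrtr ?ltW//; apply: pos_nle; [exact: ltW|exact: pos_star|].
  have := posD (pos_rscalM (ltW d0) (pos_mulC pV pG (esym GV))) pk; congr pos.
  rewrite -e1 ustarM csa mulrBr mulr1.
  have -> : c * (D - k) * c = c * (D * c) - c * k * c.
    by rewrite mulrBr mulrBl -(mulrA c D c).
  by rewrite cD (rscalC d c) addrA subrK /k -!mulrA.
have -> : x - v * (v * x * c) = g * (g * x) + v * (v * x * (1 - c)).
  have xx : x = (g * g + v * v) * x by rewrite gv1 mul1r.
  by rewrite {1}xx; ncring.
have p1sa : selfadj (1 - c) by apply: selfadjB => //; exact: selfadj1.
apply: nle_sq; first exact: sqrtr_ge0.
rewrite sqr_sqrtr//; apply: pos_nle => //; first exact: pos_star.
have pk1 : pos ((1 - c) * (D - k) * (1 - c)) by rewrite -{1}p1sa; exact: pos_conj.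
have := posD (posD (pos_rotation (g * x) (v * x * (1 - c)) gsa vsa gv gv1) pk1) pVG.
congr pos; rewrite -/m ustarM p1sa.
have -> : (1 - c) * (D - k) * (1 - c) = (1 - c) * G - (1 - c) * k * (1 - c).
  have -> : G = D - D * c by rewrite cD /D addrK.
  by ncring.
have -> : rscal r = G + m by rewrite /G subrK.
by rewrite /k; ncring.
Qed.

End Interval.

(** * The algebra inside its unitization *)

Section Embedding.
Variables (R : realType) (A : cstarAlgType R).
Local Notation U := (unitization A).
Implicit Types (p q : U) (x y z a c : A) (r s : R).

Definition inj x : U := (0, x).

Lemma injD x y : inj (x + y) = inj x + inj y.
Proof. by congr (_, _); rewrite /= addr0. Qed.
Lemma injN x : inj (- x) = - inj x.
Proof. by congr (_, _); rewrite /= oppr0. Qed.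
Lemma injB x y : inj (x - y) = inj x - inj y.
Proof. by rewrite injD injN. Qed.
Lemma injM x y : inj (x ** y) = inj x * inj y.
Proof. by congr (_, _); rewrite /= ?mulr0// !scale0r !add0r. Qed.
Lemma inj_star x : inj (cstar x) = ustar (inj x).
Proof. by congr (_, _); rewrite /= rmorph0. Qed.
Lemma inj_act p x : inj (act p x) = p * inj x.
Proof. by congr (_, _); rewrite /= ?mulr0// scale0r addr0. Qed.
Lemma inj_inj x y : inj x = inj y -> x = y. Proof. by case. Qed.

Lemma ideal_inj p : p.1 = 0 -> p = inj p.2.
Proof. by case: p => l x /= ->. Qed.
Lemma ideal_injMr x p : inj x * p = inj (inj x * p).2.
Proof. by apply: ideal_inj; rewrite /= mul0r. Qed.

Lemma nle_inj x r : nle (inj x) r <-> rnorm x <= r.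
Proof. exact: unle_inj. Qed.

Lemma nle_act p x r : nle p r -> rnorm (act p x) <= r * rnorm x.
Proof. by case. Qed.

(** The scalar part of a root of an element of [A] has square [0], so the root lies
    in [A]. *)
Lemma pos_cpositive x : pos (inj x) -> cpositive x.
Proof.
move=> [[l w] [wsa xw _]].
have l0 : l = 0.
  have : l * l = 0 by have := congr1 fst xw.
  by move=> /eqP; rewrite mulf_eq0 orbb => /eqP.
exists w; apply: inj_inj; rewrite injM inj_star xw.
by rewrite l0 in wsa *; rewrite [ustar _]wsa.
Qed.

Lemma rnorm_sub_le x y : rnorm x <= rnorm y + rnorm (x - y).
Proof. by rewrite -{1}(subrK y x) addrC; apply: rnormD. Qed.

End Embedding.

(** * Approximate units and best approximation for an element of norm 1 *)

Section UnitElement.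
Variables (R : realType) (A : cstarAlgType R) (a : A).
Hypothesis a1 : rnorm a = 1.
Local Notation U := (unitization A).
Implicit Types (p q : U) (x y z c : A) (r s : R).

Let e : U := inj a * ustar (inj a).
Let f : U := 1 - e.

Let pos_e : pos e.
Proof. by have := pos_star (ustar (inj a)); rewrite ustarK. Qed.

Let nle_e : nle e 1.
Proof.
apply: (@nleW _ _ _ (1 * 1)); first by rewrite mulr1.
by apply: nleM; [|apply: nle_ustar]; apply/nle_inj; rewrite a1.
Qed.

Let pos_f : pos f.
Proof. by apply: pos_sub1 => //; exact: pos_selfadj. Qed.

Let nle_f : nle f 1.
Proof.
apply: pos_nle1 => //.
by rewrite /f opprB addrCA subrr addr0.
Qed.

Let ef : e * f = f * e.
Proof. by rewrite /f mulrBr mulrBl mulr1 mul1r. Qed.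

Let geom n : 1 - f ^+ n = inj a * (ustar (inj a) * \sum_(i < n) f ^+ i).
Proof. by rewrite mulrA -[LHS]opprB subrX1 -mulNr opprB /f opprB addrCA subrr addr0. Qed.

(** The elements [1 - f ^+ n] of the right ideal [aA] form the candidate
    approximate unit, and [residual n x] is what they leave of [x].  As [n] grows its
    norm decreases to the distance from [x] to the closure of [aA]. *)
Definition residual n x := act (f ^+ n) x.

Lemma residual_contr n x : rnorm (residual n x) <= rnorm x.
Proof. by have := nle_act x (nle1X n nle_f); rewrite mul1r. Qed.

Lemma residualD m n x : residual (m + n) x = residual m (residual n x).
Proof. by rewrite /residual exprD actM. Qed.

Lemma residual_antitone m n x : (m <= n)%N -> rnorm (residual n x) <= rnorm (residual m x).
Proof. by move=> mn; rewrite -(subnK mn) residualD residual_contr. Qed.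

(** The square norm of [f ^+ n * a] is the norm of [f ^+ n * e * f ^+ n], small by
    [spectral_gap]. *)
Lemma residual_a n : rnorm (residual n.+1 a) ^+ 2 <= n.+1%:R^-1.
Proof.
have fsa := selfadjX n.+1 (pos_selfadj pos_f).
have h : nle (e * f ^+ n.+1) n.+1%:R^-1.
  by apply: spectral_gap => //; rewrite /f addrCA subrr addr0.
rewrite -rnorm_star -rnorm_star_mul cstarK -nle_inj injM inj_star inj_act ustarM fsa.
apply: (@nleW _ _ _ (1 * n.+1%:R^-1)); first by rewrite mul1r.
by rewrite -!mulrA (mulrA (inj a)); apply: nleM => //; exact: nle1X.
Qed.

Lemma residual_a_cvg d : 0 < d -> exists N, forall n, (N <= n)%N -> rnorm (residual n a) <= d.
Proof.
move=> d0; have [N _ hN] := near_infty_natSinv_lt (PosNum (exprn_gt0 2 d0)).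
exists N.+1 => -[//|n] Nn; rewrite -(@ler_pXn2r _ 2)// ?nnegrE ?rnorm_ge0 ?ltW//.
exact: le_lt_trans (residual_a n) (hN n Nn).
Qed.

(** By [geom] the elements [1 - f ^+ n] are right multiples of [a].  They are
    positive, bounded by [1] and increasing because [f] lies between [0] and [1].  On
    the right, convergence follows by taking adjoints. *)
Lemma approximately_right_invertible_of_dense :
  (forall x d, 0 < d -> exists n, rnorm (residual n x) <= d) -> approximately_right_invertible a.
Proof.
move=> hd.
have hd' x d : 0 < d -> exists N, forall n, (N <= n)%N -> rnorm (residual n x) <= d.
  move=> /(hd x)[N hN]; exists N => n Nn; exact: le_trans (residual_antitone x Nn) hN.
pose b n := (ustar (inj a) * \sum_(i < n) f ^+ i).2.
exists nat, leq, b.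
have ab n : inj (a ** b n) = 1 - f ^+ n.
  by rewrite injM geom /b -!inj_star -ideal_injMr.
have px n : pos (1 - f ^+ n) by exact: pos_sub1X.
split.
- split; [exact: (inhabits 0%N)|exact: leqnn| |].
    by move=> i j k; exact: leq_trans.
  by move=> i j; exists (maxn i j); split; [exact: leq_maxl|exact: leq_maxr].
- by move=> n; apply: pos_cpositive; rewrite ab.
- move=> n; rewrite -[1]/(1%:C) -rnorm_le -nle_inj ab; apply: pos_nle1 => //.
  by rewrite opprB addrCA subrr addr0; exact: posX.
- move=> i j ij; apply: pos_cpositive; rewrite injB !ab.
  have -> : 1 - f ^+ j - (1 - f ^+ i) = f ^+ i * (1 - f ^+ (j - i)).
    by rewrite mulrBr mulr1 -exprD subnKC// opprB addrC addrA subrK.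
  apply: pos_mulC => //; first exact: posX.
  by rewrite mulrBr mulrBl mulr1 mul1r -!exprD addnC.
- move=> x; apply/(@cvgrPdist_le _ _ _ eventually) => _ /gt0_realC[d d0 ->].
  have [N hN] := hd' x _ d0; exists N => // n /= /hN.
  rewrite -rnorm_le; congr (rnorm _ <= _); apply: inj_inj.
  by rewrite injB injM ab inj_act mulrBl mul1r opprB addrCA subrr addr0.
- move=> x; apply/(@cvgrPdist_le _ _ _ eventually) => _ /gt0_realC[d d0 ->].
  have [N hN] := hd' (cstar x) _ d0; exists N => // n /= /hN.
  rewrite -rnorm_le -rnorm_star; congr (rnorm _ <= _); apply: inj_inj.
  rewrite inj_star inj_act ustarM inj_star ustarK (selfadjX n (pos_selfadj pos_f)).
  by rewrite injB injM ab mulrBr mulr1 opprB addrCA subrr addr0.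
Qed.


(** The distance from [x] to the closure of [aA] is [1], expressed by the norms of
    the residuals. *)
Definition unit_dist x :=
  forall d, 0 < d -> exists N, forall n, (N <= n)%N -> `|rnorm (residual n x) - 1| <= d.

Lemma unit_dist_le x : unit_dist x -> 1 <= rnorm x.
Proof.
move=> xd; apply/ler_addgt0Pr => d d0; have [N /(_ N (leqnn _))] := xd _ d0.
by move=> /ler_normlP[h _]; have := residual_contr N x; lra.
Qed.

Lemma residualB n x y : residual n (x - y) = residual n x - residual n y.
Proof. by apply: inj_inj; rewrite injB !inj_act injB mulrBr. Qed.

Lemma rnorm_sub_dist x y : `|rnorm x - rnorm y| <= rnorm (x - y).
Proof.
by apply/ler_normlP; have := rnorm_sub_le x y; have := rnorm_sub_le y x;
   rewrite (rnormBC y); split; lra.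
Qed.

Lemma unit_dist_add x c : unit_dist x -> unit_dist (x + a ** c).
Proof.
move=> xd d d0; have d20 : 0 < d / 2 by lra.
have c0 := rnorm_ge0 c; have [N1 h1] := xd _ d20.
have [|N2 h2] := @residual_a_cvg (d / 2 / (rnorm c + 1)); first by apply: divr_gt0; lra.
exists (maxn N1 N2) => n; rewrite geq_max => /andP[l1 l2].
have := rnorm_sub_dist (residual n (x + a ** c)) (residual n x).
have -> : rnorm (residual n (x + a ** c) - residual n x) = rnorm (act (f ^+ n) a ** c).
  by rewrite -residualB addrAC subrr add0r /residual actr.
move=> h3.
have h4 : rnorm (act (f ^+ n) a ** c) <= d / 2.
  apply: le_trans (rnormM _ _) _.
  have -> : d / 2 = d / 2 / (rnorm c + 1) * (rnorm c + 1) by rewrite divfK//; lra.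
  by apply: ler_pM; rewrite ?rnorm_ge0//; [exact: h2|lra].
have := h1 _ l1; rewrite /residual => h5.
have := le_trans (ler_distD (rnorm (act (f ^+ n) x)) _ _) (lerD (le_trans h3 h4) h5).
by rewrite -splitr.
Qed.

Lemma unit_dist_lim x : (forall d, 0 < d -> exists2 y, unit_dist y & rnorm (x - y) <= d) ->
  unit_dist x.
Proof.
move=> h d d0; have d20 : 0 < d / 2 by lra.
have [y yd xy] := h _ d20; have [N hN] := yd _ d20; exists N => n /hN h1.
have := rnorm_sub_dist (residual n x) (residual n y); rewrite -residualB => h2.
have h3 := le_trans h2 (le_trans (residual_contr n _) xy).
have := le_trans (ler_distD (rnorm (residual n y)) _ _) (lerD h3 h1).
by rewrite -splitr.
Qed.

(** If all these distances vanished, [a] would be approximately right invertible;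
    an element at positive distance is rescaled. *)
Lemma unit_dist_ex : ~ approximately_right_invertible a -> exists x, unit_dist x.
Proof.
move=> na; apply: contrapT => nx; apply: na.
apply: approximately_right_invertible_of_dense => x d d0.
apply: contrapT => nd.
have hx n : d < rnorm (residual n x).
  by rewrite ltNge; apply/negP => h; apply: nd; exists n.
pose u n := rnorm (residual n x).
have nu : nonincreasing_seq u by move=> m n mn; exact: residual_antitone.
have lb : has_lbound (range u) by exists 0 => _ [n _ <-]; exact: rnorm_ge0.
have cu := nonincreasing_is_cvgn nu lb.
have l0 : 0 < limn u.
  apply: lt_le_trans d0 _; apply: limr_ge => //.
  by apply: nearW => n; exact: (ltW (hx n)).
apply: nx; exists ((limn u)^-1%:C *: x) => r r0.
have /cvgrPdist_le /(_ (limn u * r))[|N _ hN] := cu; first exact: mulr_gt0.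
exists N => n /hN /=; rewrite distrC.
have -> : residual n ((limn u)^-1%:C *: x) = (limn u)^-1%:C *: residual n x.
  by rewrite /residual /act scalerDr cmulZr !scalerA mulrC.
rewrite rnormZ ?invr_ge0 ?(ltW l0)// -/(u n) => h.
rewrite -(ler_pM2l l0); apply: le_trans h.
rewrite -{1}(ger0_norm (ltW l0)) -normrM mulrBr mulr1 mulrA divff ?gt_eqF// mul1r//.
Qed.

(** For large [N] the residual [f ^+ N * x] has norm close to [1], and
    [1 - f ^+ N * f ^+ N] maps [x] into [aA], so [truncation] moves [x] along [aA] to an
    element of smaller norm. *)
Lemma truncation_step x r d : 1 < r -> 0 < d -> unit_dist x ->
  rnorm x <= Num.sqrt (r + d) ->
  exists y, [/\ unit_dist y, rnorm y <= Num.sqrt r & rnorm (y - x) <= Num.sqrt d].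
Proof.
move=> r1 d0 xd xrd; have r0 : 0 <= r by lra.
have s1 : 0 < Num.sqrt r - 1 by rewrite subr_gt0 -{1}sqrtr1 ltr_sqrt//; lra.
have [N /(_ N (leqnn _)) /ler_normlP[_ hN]] := xd _ s1.
have gsa := selfadjX N (pos_selfadj pos_f); set g := f ^+ N in gsa.
have gg : g * g = f ^+ (N + N) by rewrite exprD.
have [v [vsa vv vc]] : pos (1 - g * g) by rewrite gg; exact: pos_sub1X.
have vg : v * g = g * v.
  by apply: vc; rewrite mulrBl mulrBr mulr1 mul1r mulrA.
have gv1 : g * g + v * v = 1 by rewrite -vv addrC subrK.
have [||c [c1 c2]] := truncation gsa vsa (esym vg) gv1 r0 d0 _
  (_ : nle (inj x) (Num.sqrt (r + d))).
- by rewrite -inj_act; apply/nle_inj; lra.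
- exact/nle_inj.
have [w wE] : exists w, v * (v * inj x * c) = inj (a ** w).
  exists (inj (act (ustar (inj a) * \sum_(i < N + N) f ^+ i) x) * c).2.
  rewrite injM -ideal_injMr inj_act.
  have -> : v * (v * inj x * c) = v * v * inj x * c by rewrite !mulrA.
  by rewrite -vv gg geom !mulrA.
exists (x - a ** w); split.
- by rewrite -cmulN; exact: unit_dist_add.
- by apply/nle_inj; rewrite injB -wE.
- by rewrite rnormBC opprB addrC subrK; apply/nle_inj; rewrite -wE.
Qed.

(** Starting from any [x0] at distance [1], truncation steps bring the square of the
    norm from [1 + t ^+ 2] to [1 + (t / 2) ^+ 2] by a displacement of size at most
    [t].  As [t] is halved each time the displacements are summable, and the limit has
    norm and distance [1]. *)
Lemma proximinal : ~ approximately_right_invertible a ->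
  exists k, rnorm k <= 1 /\ forall c, 1 <= rnorm (k + a ** c).
Proof.
move=> /unit_dist_ex[x0 x0d].
pose s := rnorm x0 + 1; have s1 : 1 <= s by have := rnorm_ge0 x0; rewrite /s; lra.
pose inv k x := unit_dist x /\ rnorm x <= Num.sqrt (1 + (s / 2 ^+ k) ^+ 2).
have p2 k : 0 < s / 2 ^+ k by apply: divr_gt0; [lra|apply: exprn_gt0].
have step kx : exists y, inv kx.1 kx.2 ->
    inv kx.1.+1 y /\ rnorm (y - kx.2) <= s / 2 ^+ kx.1.
  case: kx => k x /=; have [h|h] := pselect (inv k x); last by exists x.
  case: h => xd xb.
  have pk := p2 k; have := p2 k.+1; rewrite exprS invfM mulrCA => pk1.
  set t := s / 2 ^+ k in pk pk1 xb *.
  have [||//||y [yd yb yx]] :=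
    @truncation_step x (1 + (t / 2) ^+ 2) (t ^+ 2 * (3/4)).
  - by rewrite ltrDl exprn_gt0//; lra.
  - by apply: mulr_gt0; [exact: exprn_gt0|lra].
  - by rewrite (_ : 1 + (t / 2) ^+ 2 + t ^+ 2 * (3/4) = 1 + t ^+ 2)//; field.
  exists y => _; split.
    by split => //; rewrite (exprS 2 k) invfM mulrCA -/t mulrC.
  apply: le_trans yx _; rewrite -[leRHS]gtr0_norm// -sqrtr_sqr ler_sqrt ?sqr_ge0//.
  by rewrite ger_pMr ?exprn_gt0//; lra.
have [F hF] := choice step.
pose u := fix u n := if n is m.+1 then F (m, u m) else x0.
have uS n : u n.+1 = F (n, u n) by [].
have uinv n : inv n (u n).
  elim: n => [|n ih]; last by have [] := hF (n, u n) ih.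
  split=> //; rewrite expr0 divr1; apply: (@le_trans _ _ s); first by rewrite /s; lra.
  rewrite -[leLHS]gtr0_norm; last lra.
  by rewrite -sqrtr_sqr ler_sqrt; have := sqr_ge0 s; lra.
have ud n : rnorm (u n.+1 - u n) <= - (2 * s / 2 ^+ n.+1) - - (2 * s / 2 ^+ n).
  have [_ /= h] := hF (n, u n) (uinv n); apply: le_trans h _.
  rewrite le_eqVlt; apply/orP; left; apply/eqP.
  by rewrite exprS; field; rewrite expf_neq0.
have [|k hk] := complete_dominated ud (K := 0).
  by move=> n; rewrite oppr_le0 -mulrA mulr_ge0// ltW.
have kd : unit_dist k.
  apply: unit_dist_lim => d /hk[N /(_ N (leqnn _)) h].
  by exists (u N) => //; have [] := uinv N.
exists k; split; last by move=> c; apply/unit_dist_le/unit_dist_add.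
apply/ler_addgt0Pr => d d0; have d20 : 0 < d / 2 by lra.
have [N hN] := hk _ d20.
have : (fun n => Num.sqrt (1 + (s * (1/2) ^+ n) ^+ 2)) @ \oo --> Num.sqrt (1 + (s * 0) ^+ 2).
  apply: (@cvg_comp _ _ _ (fun n => 1 + (s * (1/2) ^+ n) ^+ 2) Num.sqrt).
    apply: cvgD; first exact: cvg_cst.
    apply: (@cvg_comp _ _ _ (fun n => s * (1/2) ^+ n) (fun t => t ^+ 2)).
      apply: cvgM; first exact: cvg_cst.
      by apply: cvg_expr; rewrite ger0_norm; lra.
    exact: exprn_continuous.
  exact: sqrt_continuous.
rewrite mulr0 expr0n addr0 sqrtr1 => /cvgrPdist_le /(_ _ d20)[M _ hM].
have := hM (maxn N M) (leq_maxr _ _); have := hN _ (leq_maxl N M).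
have [_] := uinv (maxn N M).
set m := maxn N M; rewrite div1r exprVn => h1 h2 /= /ler_normlP[h3 h4].
have := rnorm_sub_le k (u m); lra.
Qed.

(** Take [b := (1 - e) k] with [k] from [proximinal].  Adding [a ** c] to [b] amounts
    to adding another element of [aA] to [k], and [b] is no longer than [k], which
    gives that [b] is orthogonal to [a].  Conversely the elements [b ** c] lie in the
    range of [1 - e], which [e ^+ n] annihilates asymptotically, whereas [e ^+ n]
    preserves the norm of [a]. *)
Lemma norm1_mutual_neighbor : ~ approximately_right_invertible a ->
  exists b, [/\ b != 0, strong_BJ a b & strong_BJ b a].
Proof.
move=> /proximinal[k [k1 kd]].
(* b + a c is k plus the element a (c - star a k), since b = k - a (star a k). *)
have fk c : act f k + a ** c = k + a ** (c - cstar a ** k).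
  have -> : act f k = k - a ** (cstar a ** k).
    apply: inj_inj; rewrite inj_act injB !injM inj_star /f /e.
    by rewrite mulrBl mul1r mulrA.
  by rewrite cmulDr cmulN -addrA (addrC (- _)).
have fk1 : rnorm (act f k) <= 1.
  by apply: le_trans (nle_act k nle_f) _; rewrite mul1r.
exists (act f k); split.
- apply/eqP => fk0; have := kd (0 - cstar a ** k).
  by rewrite -fk fk0 cmul0 addr0 rnorm0; lra.
- move=> c; rewrite -rnormE -rnormE lecR a1 leNgt; apply/negP => lt1.
  set y := k ** c; set t := rnorm (a + act f k ** c) in lt1.
  have t0 : 0 <= t := rnorm_ge0 _.
  have y0 := rnorm_ge0 y; pose d := (1 - t) / 2 / (rnorm y + 1).
  have d0 : 0 < d by rewrite /d divr_gt0//; lra.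
  have [N _ hN] := near_infty_natSinv_lt (PosNum d0).
  (* With n + 2 a power of 2, iterated square roots turn a bound of e ^+ n.+2
     below 1 into a bound of e below 1, against the norm of a being 1. *)
  pose n := (2 ^ N.+1).-2.
  have nE : n.+2 = (2 ^ N.+1)%N.
    rewrite /n -[RHS]prednK ?expn_gt0//; congr S.
    by rewrite prednK// -subn1 subn_gt0 -{1}(expn0 2) ltn_exp2l.
  have Nn : (N <= n)%N.
    by rewrite -ltnS -ltnS nE ltn_expl.
  have gap : rnorm (act (e ^+ n.+1 * f) y) <= (1 - t) / 2.
    have h : nle (e ^+ n.+1 * f) d.
      apply: (@nleW _ _ _ n.+1%:R^-1); first exact: ltW (hN n Nn).
      rewrite -[e ^+ _ * f](commrX n.+1 (esym ef)).
      by apply: spectral_gap => //; rewrite /f addrC ?subrK// addrC subrK.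
    apply: le_trans (nle_act y h) _; rewrite /d mulrAC ler_pdivrMr; last lra.
    by rewrite ler_pM2l; lra.
  have ea : rnorm (act (e ^+ n.+1) a) <= (1 + t) / 2.
    have -> : act (e ^+ n.+1) a = act (e ^+ n.+1) (a + act f k ** c) - act (e ^+ n.+1 * f) y.
      rewrite actM /y actr; apply: inj_inj; rewrite injB !inj_act injD.
      by rewrite -mulrBr addrK.
    apply: le_trans (rnormB _ _) _.
    by have := nle_act (a + act f k ** c) (nle1X n.+1 nle_e); rewrite mul1r -/t; lra.
  have h : nle (e ^+ n.+2) ((1 + t) / 2).
    rewrite exprSr {2}/e mulrA; apply: (@nleW _ _ _ ((1 + t) / 2 * 1)).
      by rewrite mulr1.
    apply: nleM; first by rewrite -inj_act; apply/nle_inj.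
    by apply: nle_ustar; apply/nle_inj; rewrite a1.
  rewrite nE in h; have [|q q1 eq1] := nle_root (pos_selfadj pos_e) _ h; first lra.
  move: eq1; rewrite /e -inj_star -injM => /nle_inj.
  by rewrite -{1}(cstarK a) rnorm_star_mul rnorm_star a1 expr1n; lra.
- move=> c; rewrite -!rnormE lecR fk; apply: le_trans fk1 (kd _).
Qed.

End UnitElement.

Lemma mutual_neighbor (R : realType) (A : cstarAlgType R) (a : A) : a != 0 ->
  ~ approximately_right_invertible a ->
  exists b, [/\ b != 0, strong_BJ a b & strong_BJ b a].
Proof.
move=> a0 na.
have n0 : 0 < rnorm a.
  by rewrite lt_neqAle rnorm_ge0 andbT eq_sym; apply: contra_neq a0; exact: rnorm_eq0.
pose l : R[i] := (rnorm a)%:C.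
have l0 : l != 0 by rewrite /l fmorph_eq0 gt_eqF.
have aE : a = l *: (l^-1 *: a) by rewrite scalerA divff// scale1r.
have a1 : rnorm (l^-1 *: a) = 1.
  by rewrite /l -fmorphV rnormZ ?invr_ge0 ?ltW// mulVf// gt_eqF.
case: (norm1_mutual_neighbor a1).
  move=> [I [le [b hb]]]; apply: na; exists I, le, (fun i => l^-1 *: b i).
  have -> : (fun i => a ** (l^-1 *: b i)) = (fun i => (l^-1 *: a) ** b i).
    by apply/funext => i; rewrite cmulZr cmulZl.
  exact: hb.
move=> b [b0 ab ba]; exists b; split=> // c.
  have -> : a + b ** c = l *: (l^-1 *: a + b ** (l^-1 *: c)).
    by rewrite scalerDr -aE cmulZr scalerA divff// scale1r.
  by rewrite {1}aE !(normrZ l) ler_wpM2l.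
by rewrite aE cmulZl -cmulZr; exact: ba.
Qed.

Theorem proposition2p6 (R : realType) (A : cstarAlgType R) (a : A) (a0 : a != 0) :
  ~ approximately_right_invertible a ->
  ~ isolated_point (vertex a0) /\
  (exists b : A, b != 0 /\ mutual_strong_BJ a b).
Proof.
move=> na; have [b [b0 ab ba]] := mutual_neighbor a0 na.
split; last by exists b.
by move=> /(_ (vertex b0)); apply; left; exists a, b, a0, b0; split.
Qed.
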